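(* Let $P,Q,R,S,F,G:[t_0,+\infty)\times\mathbb{R}\times\mathbb{R}\to\mathbb{R}$ be locally integrable and locally bounded in $t$ and continuous in $(u,v)$ (in the sense made precise in the context). Let $P_0,Q_0,R_0,S_0,F_0,G_0$ be real-valued locally integrable functions on $[t_0,+\infty)$ such that for all $t\ge t_0$ and $u,v\in\mathbb{R}$ $$P(t,u,v)\le P_0(t),\quad |Q(t,u,v)|\le Q_0(t),\quad |R(t,u,v)|\le R_0(t),$$ $$S(t,u,v)\le S_0(t),\quad |F(t,u,v)|\le F_0(t),\quad |G(t,u,v)|\le G_0(t).$$ Consider the system $$\text{(A)}\quad \phi'=P(t,\phi,\psi)\phi+Q(t,\phi,\psi)\psi+F(t,\phi,\psi),\qquad \psi'=R(t,\phi,\psi)\phi+S(t,\phi,\psi)\psi+G(t,\phi,\psi),\qquad t\ge t_0,$$ the system $$\text{(B)}\quad \phi'=P(t,\phi,\psi)\phi+Q(t,\phi,\psi)\psi,\qquad \psi'=R(t,\phi,\psi)\phi+S(t,\phi,\psi)\psi,\qquad t\ge t_0,$$ the linear system $$\text{(C)}\quad \phi'=P_0(t)\phi+Q_0(t)\psi+F_0(t),\qquad \psi'=R_0(t)\phi+S_0(t)\psi+G_0(t),\qquad t\ge t_0,$$ and the corresponding homogeneous linear system $$\text{(D)}\quad \phi'=P_0(t)\phi+Q_0(t)\psi,\qquad \psi'=R_0(t)\phi+S_0(t)\psi,\qquad t\ge t_0.$$ Then the following statements hold. I) For every $\alpha,\beta\in\mathbb{R}$ the solution $(\phi(t),\psi(t))$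 of (A) with $\phi(t_0)=\alpha$, $\psi(t_0)=\beta$ exists on $[t_0,+\infty)$. II) If a solution $(\phi_0(t),\psi_0(t))$ of (C) with $\phi_0(t_0)>0$, $\psi_0(t_0)>0$ is bounded on $[t_0,+\infty)$, then every solution $(\phi(t),\psi(t))$ of (A) with $|\phi(t_0)|\le\phi_0(t_0)$, $|\psi(t_0)|\le\psi_0(t_0)$ is also bounded on $[t_0,+\infty)$. If such a solution $(\phi_0(t),\psi_0(t))$ of (C) vanishes at $+\infty$, then every solution $(\phi(t),\psi(t))$ of (A) with $|\phi(t_0)|\le\phi_0(t_0)$, $|\psi(t_0)|\le\psi_0(t_0)$ also vanishes at $+\infty$. III) If the system (D) is Lyapunov stable, then the null solution $(0,0)$ of (B) is Lyapunov stable. If the system (D) is asymptotically stable, then the null solution $(0,0)$ of (B) is globally asymptotically stable.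
   Context: Regularity: each of $P,Q,R,S,F,G$ is measurable (locally integrable) in $t$ for each fixed $(u,v)$, continuous in $(u,v)$ for each fixed $t$, and bounded on every compact subset of $[t_0,+\infty)\times\mathbb{R}\times\mathbb{R}$. A solution of a system on $[t_1,t_2)$ ($t_0\le t_1<t_2\le+\infty$) is a pair $(\phi,\psi)$ of absolutely continuous functions on $[t_1,t_2)$ (locally absolutely continuous) satisfying the system almost everywhere on $[t_1,t_2)$. $[t_0,T)$ is the maximum existence interval of a solution if the solution satisfies the system almost everywhere on $[t_0,T)$ and cannot be continued to the right of $T$ as a solution. ''The solution with given initial data exists on $[t_0,+\infty)$'' means that any solution with these initial data has maximum existence interval $[t_0,+\infty)$ (uniqueness is not claimed). ''Vanishes at $+\infty$'' means that both components tend to $0$ as $t\to+\infty$. A solution $(\phi_0,\psi_0)$ of a system is Lyapunov stable if for every $\varepsilon>0$ there is $\delta>0$ such that every solution $(\phi,\psi)$ with $|\phi(t_0)-\phi_0(t_0)|\le\delta$, $|\psi(t_0)-\psi_0(t_0)|\le\delta$ satisfies $|\phi(t)-\phi_0(t)|\le\varepsilon$, $|\psi(t)-\psi_0(t)|\le\varepsilon$ for all $t\ge t_0$. It is asymptotically stable if there is $\delta>0$ such that every solution $(\phi,\psi)$ with $|\phi(t_0)-\phi_0(t_0)|\le\delta$, $|\psi(t_0)-\psi_0(t_0)|\le\delta$ satisfies $\lim_{t\to+\infty}(\phi(t)-\phi_0(t))=\lim_{t\to+\infty}(\psi(t)-\psi_0(t))=0$. It is globally asymptotically stable if for every solution $(\phi,\psi)$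 of the system, $\phi(t)-\phi_0(t)$ and $\psi(t)-\psi_0(t)$ tend to $0$ as $t\to+\infty$. The linear homogeneous system (D) is called Lyapunov (asymptotically) stable if its null solution (equivalently each of its solutions) is. *)

(* Defs.v *)
From HB Require Import structures.
From mathcomp Require Import all_boot all_order all_algebra.
From mathcomp Require Import all_classical all_reals all_analysis.

Set Implicit Arguments.
Unset Strict Implicit.
Unset Printing Implicit Defensive.

Import Order.TTheory GRing.Theory Num.Theory.
Import numFieldNormedType.Exports.

Local Open Scope classical_set_scope.
Local Open Scope ring_scope.

(* A function on [t0, +oo) is a total function of which only the values at
   t >= t0 matter; a function on [t0, +oo) x R x R is a curried one. *)

(* The completed measure is used because [lebesgue_measure] lives on the Borel
   sigma-algebra, whereas measurability here is Lebesgue measurability.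
   If b < t0 then `[t0, b] is empty. *)
Definition loc_integrable (R : realType) (t0 : R) (h : R -> R) : Prop :=
  forall b : R,
    (@completed_lebesgue_measure R).-integrable `[t0, b] (EFin \o h).

Definition regular_coef (R : realType) (t0 : R) (h : R -> R -> R -> R) : Prop :=
  [/\ forall u v : R, loc_integrable t0 (fun t => h t u v),
      forall t : R, t0 <= t -> continuous (fun z : R * R => h t z.1 z.2) &
      forall K : set (R * R * R), compact K ->
        K `<=` [set x | t0 <= x.1.1] ->
        [bounded h x.1.1 x.1.2 x.2 | x in K]].

Definition abs_continuous (R : realType) (a b : R) (h : R -> R) : Prop :=
  forall e : R, 0 < e -> exists2 d : R, 0 < d &
    forall (n : nat) (x y : 'I_n -> R),
      (forall i, a <= x i /\ x i <= y i /\ y i <= b) ->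
      trivIset [set: 'I_n] (fun i => `]x i, y i[%classic) ->
      \sum_(i < n) (y i - x i) < d ->
      \sum_(i < n) `|h (y i) - h (x i)| < e.

Definition loc_abs_continuous (R : realType) (t1 : R) (t2 : \bar R)
    (h : R -> R) : Prop :=
  forall b : R, t1 <= b -> (b%:E < t2)%E -> abs_continuous t1 b h.

(* (phi, psi) is a solution on [t1, t2) of
     phi' = X (t, phi, psi), psi' = Y (t, phi, psi). *)
Definition is_solution (R : realType) (X Y : R -> R -> R -> R)
    (t1 : R) (t2 : \bar R) (phi psi : R -> R) : Prop :=
  [/\ (t1%:E < t2)%E,
      loc_abs_continuous t1 t2 phi, loc_abs_continuous t1 t2 psi &
      {ae (@lebesgue_measure R), forall t : R, t1 <= t -> (t%:E < t2)%E ->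
        is_derive t 1 phi (X t (phi t) (psi t)) /\
        is_derive t 1 psi (Y t (phi t) (psi t))}].

(* [t0, T) is the maximum existence interval of the solution (phi, psi). *)
Definition is_maximal_solution (R : realType) (X Y : R -> R -> R -> R)
    (t0 : R) (T : \bar R) (phi psi : R -> R) : Prop :=
  is_solution X Y t0 T phi psi /\
  ~ (exists (T' : \bar R) (phi1 psi1 : R -> R),
      [/\ (T < T')%E, is_solution X Y t0 T' phi1 psi1 &
          forall t : R, t0 <= t -> (t%:E < T)%E ->
            phi1 t = phi t /\ psi1 t = psi t]).

Definition bounded_pair (R : realType) (t0 : R) (phi psi : R -> R) : Prop :=
  [bounded phi t | t in `[t0, +oo[] /\ [bounded psi t | t in `[t0, +oo[].

Definition vanishes (R : realType) (phi psi : R -> R) : Prop :=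
  phi t @[t --> +oo] --> (0 : R) /\ psi t @[t --> +oo] --> (0 : R).

(* In the three notions of stability the neighbouring solutions are taken on
   their maximum existence intervals, which are required to be [t0, +oo). *)
Definition lyapunov_stable (R : realType) (X Y : R -> R -> R -> R) (t0 : R)
    (phi0 psi0 : R -> R) : Prop :=
  forall e : R, 0 < e -> exists2 d : R, 0 < d &
    forall (T : \bar R) (phi psi : R -> R),
      is_maximal_solution X Y t0 T phi psi ->
      `|phi t0 - phi0 t0| <= d -> `|psi t0 - psi0 t0| <= d ->
      T = +oo%E /\
      forall t : R, t0 <= t ->
        `|phi t - phi0 t| <= e /\ `|psi t - psi0 t| <= e.

(* Attractivity only: Lyapunov stability is not part of this definition. *)
Definition asymptotically_stable (R : realType) (X Y : R -> R -> R -> R)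
    (t0 : R) (phi0 psi0 : R -> R) : Prop :=
  exists2 d : R, 0 < d &
    forall (T : \bar R) (phi psi : R -> R),
      is_maximal_solution X Y t0 T phi psi ->
      `|phi t0 - phi0 t0| <= d -> `|psi t0 - psi0 t0| <= d ->
      T = +oo%E /\ vanishes (phi \- phi0) (psi \- psi0).

Definition globally_asymptotically_stable (R : realType)
    (X Y : R -> R -> R -> R) (t0 : R) (phi0 psi0 : R -> R) : Prop :=
  forall (T : \bar R) (phi psi : R -> R),
    is_maximal_solution X Y t0 T phi psi ->
    T = +oo%E /\ vanishes (phi \- phi0) (psi \- psi0).

Definition rhs (R : realType) (a b c : R -> R -> R -> R) : R -> R -> R -> R :=
  fun t u v => a t u v * u + b t u v * v + c t u v.

Definition rhs_hom (R : realType) (a b : R -> R -> R -> R) : R -> R -> R -> R :=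
  fun t u v => a t u v * u + b t u v * v.

Definition lin_rhs (R : realType) (a b c : R -> R) : R -> R -> R -> R :=
  fun t u v => a t * u + b t * v + c t.

Definition lin_rhs_hom (R : realType) (a b : R -> R) : R -> R -> R -> R :=
  fun t u v => a t * u + b t * v.

(* Main.v *)
Require Import Defs.
From HB Require Import structures.
From mathcomp Require Import all_boot all_order all_algebra.
From mathcomp Require Import all_classical all_reals all_analysis.
From mathcomp Require Import measurable_realfun ring lra.

(** The proof rests on two facts about locally absolutely continuous functions.
    Such a function is nondecreasing when its derivative is nonnegative almost
    everywhere ([ac_nondecreasing]), and the integral of a locally integrable
    function is locally absolutely continuous with the expected derivative
    ([loc_integrable_primitive]). The first fact gives Gronwall's lemma
    ([gronwall]).

    Comparison. Since [p <= p0], [s <= s0] and the other coefficients are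
    bounded in absolute value, the absolute values of the components of a
    solution of (A) grow at most at the rate at which a nonnegative solution of
    (C) grows. Moreover [q0] and [r0] are nonnegative, so that an increase of
    one component of a solution of (C) can only increase the other one. Hence the
    inequalities [`|phi| <= phi0] and [`|psi| <= psi0] persist once they hold at
    [t0] ([comparison]). Analytically, the sum of the squares of the positive
    parts of [phi - phi0], [- phi - phi0], [psi - psi0], [- psi - psi0] starts
    at [0] and satisfies a linear differential inequality
    ([quasimonotone_le0]). Boundedness and convergence to [0] pass from the
    dominating solution to the dominated one. For the statements on stability
    the dominating solution is the solution of (D) that starts from [(d, d)],
    or a multiple of it when the initial data of (B) are arbitrary.

    Existence. The same one-sided estimates bound the growth of
    [1 + phi ^+ 2 + psi ^+ 2], which gives an a priori bound [M t]
    ([growth_bound]). The system whose arguments are truncated at [M t] has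
    right-hand sides dominated by integrable functions of time. It is solved by
    Tonelli's method: the equation with a small delay can be solved interval by
    interval, its solutions are equicontinuous, and dominated convergence
    identifies the limit of a subsequence as a solution
    ([caratheodory_bounded_exists]). By the a priori bound this solution does
    not see the truncation ([global_solution_exists]). This existence theorem
    covers the linear system (D) as well as (A), because it only asks for
    integrable bounds on bounded sets of arguments.

    Continuation. A solution on a bounded interval [[t0, r[] is bounded. Solving
    globally the system whose right-hand sides are frozen along this solution
    before [r] gives a continuation of it ([maximal_solution_global]). *)

Set Implicit Arguments.
Unset Strict Implicit.
Unset Printing Implicit Defensive.

Import Order.TTheory GRing.Theory Num.Theory.
Import numFieldNormedType.Exports.

Local Open Scope classical_set_scope.
Local Open Scope ring_scope.

(** * Absolutely continuous functions *)

(** An interval is swept from left to right: the supremum of the points reached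
    so far is reached, and it can be passed unless it is [b]. The step goes
    from any [x] just before [s] to any [y] just after it, so that a cover by
    neighbourhoods of each point can be used without extracting a partition. *)
Lemma real_induction (R : realType) (a b : R) (P : R -> Prop) :
  a <= b -> P a ->
  (forall s, a <= s -> s <= b -> exists2 d, 0 < d & forall x y,
     a <= x -> x <= s -> s <= y -> y <= b -> s - d < x -> y < s + d ->
     P x -> P y) ->
  P b.
Proof.
move=> ab Pa step; pose S := [set c | [/\ a <= c, c <= b & P c]].
have Sa : S a by [].
have Sub : ubound S b by move=> c [].
have hS : has_sup S by split; [exists a | exists b].
have as_ : a <= sup S by apply: ub_le_sup => //; exists b.
have sb : sup S <= b by apply: ge_sup => //; exists a.
have [d d0 stepd] := step _ as_ sb.
have [x [ax xb Px] sx] := sup_adherent d0 hS.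
have xs : x <= sup S by apply: ub_le_sup => //; exists b.
have [bd|db] := ltP b (sup S + d).
  exact: (stepd x b ax xs sb (lexx b) sx bd Px).
have yb : sup S + d / 2 <= b by apply: le_trans db; lra.
have : S (sup S + d / 2).
  split=> //; first by lra.
  by apply: (stepd x) => //; lra.
by move=> /(ub_le_sup (ex_intro _ b Sub)); lra.
Qed.

Lemma is_derive_near (R : realType) (h : R -> R) (s l e : R) :
  is_derive s 1 h l -> 0 < e -> exists2 d, 0 < d &
    forall y, `|y - s| < d -> `|h y - h s - l * (y - s)| <= e * `|y - s|.
Proof.
move=> [hs <-] e0; have := hs => /cvgrPdist_le /(_ _ e0).
rewrite -/(derive h s 1) => /nbhs_ballP[d /= d0 hd].
exists d => // y ysd; have [->|ys] := eqVneq y s.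
  by rewrite !subrr mulr0 subr0 normr0 mulr0.
have ys0 : y - s != 0 by rewrite subr_eq0.
have /= := hd (y - s).
rewrite /ball /= sub0r normrN => /(_ ysd ys0).
rewrite [_%:A]mulr1 subrK => hle.
rewrite -ler_pdivrMr ?normr_gt0// -normfV -normrM mulrBl mulfK//.
by rewrite distrC mulrC.
Qed.

Lemma is_derive_from_near (R : realType) (h : R -> R) (s l : R) :
  (forall e, 0 < e -> exists2 d, 0 < d &
    forall y, `|y - s| < d -> `|h y - h s - l * (y - s)| <= e * `|y - s|) ->
  is_derive s 1 h l.
Proof.
move=> H.
have cv : k^-1 *: ((h \o shift s) (k *: 1) - h s) @[k --> 0^'] --> l.
  apply/cvgrPdist_le => e e0; have [d d0 hd] := H e e0.
  apply/nbhs_ballP; exists d => //= y; rewrite /ball/= sub0r normrN => yd y0.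
  have := hd (y + s); rewrite addrK => /(_ yd).
  rewrite -[_%:A]mulr1 [y%:A]mulr1 -ler_pdivrMr ?normr_gt0//.
  by rewrite -normfV -normrM mulrBl mulfK// distrC mulrC mulr1.
by apply: DeriveDef; [apply: cvgP cv|apply/cvg_lim].
Qed.

(** The same condition for lists of non-overlapping intervals in increasing
    order, which can be lengthened one interval at a time. *)
Lemma abs_continuous_seq (R : realType) (a b : R) (h : R -> R) (e : R) :
  abs_continuous a b h -> 0 < e -> exists2 d, 0 < d &
  forall s : seq (R * R),
    all (fun p => [&& a <= p.1, p.1 <= p.2 & p.2 <= b]) s ->
    pairwise (fun p q => p.2 <= q.1) s ->
    \sum_(p <- s) (p.2 - p.1) < d -> \sum_(p <- s) `|h p.2 - h p.1| < e.
Proof.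
move=> ac e0; have [d d0 hd] := ac e e0; exists d => // s sab ps.
rewrite (big_nth (0, 0)) big_mkord => sd.
rewrite (big_nth (0, 0)) big_mkord; apply: hd sd.
  move=> i; have /(allP sab)/and3P[] := mem_nth (0, 0) (ltn_ord i).
  by move=> *; split.
move=> i j _ _ [t []] /=; rewrite !in_itv/= => /andP[it ti] /andP[jt tj].
apply/val_inj; case: (ltngtP i j) => // ij; exfalso.
  by have := @pairwiseP _ _ ((0, 0) : R * R) _ ps i j (ltn_ord i) (ltn_ord j) ij; lra.
by have := @pairwiseP _ _ ((0, 0) : R * R) _ ps j i (ltn_ord j) (ltn_ord i) ij; lra.
Qed.

Lemma sum_len_le_open (R : realType) (U : set R) (s : seq (R * R)) :
  measurable U ->
  all (fun p => p.1 <= p.2) s ->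
  (forall p, p \in s -> `]p.1, p.2[ `<=` U) ->
  pairwise (fun p q => p.2 <= q.1) s ->
  ((\sum_(p <- s) (p.2 - p.1))%:E <= @lebesgue_measure R U)%E.
Proof.
move=> mU; elim: s U mU => [|[x y] s IH] U mU /=.
  by rewrite big_nil measure_ge0.
move=> /andP[xy als] sU /andP[ys ps]; rewrite big_cons EFinD /=.
have -> : U = (U `&` `]-oo, y[) `|` (U `&` `[y, +oo[).
  rewrite -setIUr -itv_bndbnd_setU// ?setIT//.
  by rewrite set_itvE setIT.
rewrite measureU//=; [|exact: measurableI|exact: measurableI|]; last first.
  rewrite -subset0 => t [[_ /=]]; rewrite in_itv/= => ty [_ /=].
  by rewrite in_itv/= andbT; lra.
apply: leeD.
  have xyl : (y - x)%:E = @lebesgue_measure R `]x, y[.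
    rewrite lebesgue_measure_itv/= lte_fin; case: ltP => //.
    by move=> yx; congr (_%:E); lra.
  rewrite xyl; apply: le_measure; rewrite ?inE//=; first exact: measurableI.
  move=> t txy; split; first by apply: (sU (x, y)) => //; rewrite mem_head.
  by move: txy; rewrite /= !in_itv/= => /andP[].
apply: IH => //; first exact: measurableI.
move=> p pin t tp; split.
  by apply: (sU p) => //; rewrite in_cons pin orbT.
have /= := allP ys _ pin; move: tp; rewrite /= !in_itv/= andbT.
by move=> /andP[+ _]; lra.
Qed.

(** The exceptional null set is covered by an open set [U] of measure less than
    the [d] of absolute continuity. Moving from left to right, near a point
    outside the null set [h] decreases by at most [e1] times the length, and
    near a point of the null set the step is recorded as an interval contained
    in [U]. The recorded intervals have total length less than [d], so that [h]
    loses less than [e / 2] on them. *)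
Lemma ac_nondecreasing (R : realType) (a b : R) (h : R -> R) :
  a <= b -> abs_continuous a b h ->
  {ae (@lebesgue_measure R), forall t, a <= t -> t <= b ->
     exists2 l, is_derive t 1 h l & 0 <= l} ->
  h a <= h b.
Proof.
move=> ab ach [N [mN N0 subN]].
apply/ler_addgt0Pr => e e0.
(* The length is increased by 1 so that [e1] makes sense when [a = b]. *)
pose e1 := e / 2 / (b - a + 1).
have e10 : 0 < e1 by rewrite divr_gt0 ?divr_gt0//; lra.
have e20 : 0 < e / 2 by rewrite divr_gt0.
have [d d0 hd] := abs_continuous_seq ach e20.
have Nfin : (@lebesgue_measure R N < +oo)%E by rewrite N0.
have [U [oU NU muU]] := lebesgue_regularity_outer mN Nfin d0.
have mU : measurable U by exact: open_measurable.
have Ud : (@lebesgue_measure R U < d%:E)%E.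
  rewrite -(setDUK NU) setUC measureU0//; exact: measurableD.
pose P c := exists s : seq (R * R),
  [/\ all (fun p => [&& a <= p.1, p.1 <= p.2 & p.2 <= c]) s,
      pairwise (fun p q => p.2 <= q.1) s,
      (forall p, p \in s -> `]p.1, p.2[ `<=` U) &
      h a <= h c + e1 * (c - a) + \sum_(p <- s) `|h p.2 - h p.1|].
suff [s [sab ps sU hle]] : P b.
  have lt1 : \sum_(p <- s) (p.2 - p.1) < d.
    rewrite -lte_fin; apply: le_lt_trans Ud; apply: sum_len_le_open => //.
    by apply: sub_all sab => p /and3P[].
  have := hd s sab ps lt1.
  have : e1 * (b - a) <= e / 2.
    rewrite /e1 mulrAC ler_pdivrMr; last by lra.
    by rewrite ler_wpM2l//; lra.
  by move: hle; lra.
apply: (@real_induction _ a b) => //.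
  by exists [::]; rewrite big_nil; split => //; lra.
move=> s as_ sb; have [Ns|Ns] := pselect (N s).
  have /nbhs_ballP[r /= r0 rU] := oU _ (NU _ Ns).
  exists r => // x y ax xs sy yb rx ry [l [lab pl lU hl]].
  exists (rcons l (x, y)); split.
  - rewrite all_rcons/= ax lexx (le_trans xs sy)/=.
    apply: sub_all lab => p /and3P[-> -> /= /le_trans]; apply.
    exact: le_trans xs sy.
  - rewrite pairwise_rcons pl andbT.
    by apply: sub_all lab => p /and3P[].
  - move=> p; rewrite mem_rcons in_cons => /predU1P[->/=|]; last exact: lU.
    move=> t /=; rewrite in_itv/= => /andP[xt ty]; apply: rU.
    by rewrite /ball/= ltr_norml; lra.
  - rewrite big_rcons/= -/(\sum_(_ <- _) _).
    have : h x <= h y + `|h y - h x|.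
      by rewrite -lerBlDl -normrN opprB ler_norm.
    have : e1 * (x - a) <= e1 * (y - a) by rewrite ler_wpM2l; lra.
    by move: hl; lra.
have : exists2 l, is_derive s 1 h l & 0 <= l.
  by apply: contrapT => ns; apply: Ns; apply: subN => /= /(_ as_ sb).
move=> [l hsl l0]; have [r r0 hr] := is_derive_near hsl e10.
exists r => // x y ax xs sy yb rx ry [ls [lab pl lU hl]].
exists ls; split => //.
  apply: sub_all lab => p /and3P[-> -> /= /le_trans]; apply.
  exact: le_trans xs sy.
have lx : 0 <= l * (s - x) by rewrite mulr_ge0//; lra.
have ly : 0 <= l * (y - s) by rewrite mulr_ge0//; lra.
have hx : h x <= h s + e1 * (s - x).
  have := hr x; rewrite distrC ger0_norm; last by lra.
  move=> /(_ ltac:(lra)); rewrite ler_norml => /andP[_]; lra.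
have hy : h s <= h y + e1 * (y - s).
  have := hr y; rewrite [`|y - s|]ger0_norm; last by lra.
  move=> /(_ ltac:(lra)); rewrite ler_norml => /andP[+ _]; lra.
by move: hl hx hy; lra.
Qed.

Lemma ae_imp2 (R : realType) (P Q S : R -> Prop) :
  {ae (@lebesgue_measure R), forall t, P t} ->
  {ae (@lebesgue_measure R), forall t, Q t} ->
  (forall t, P t -> Q t -> S t) ->
  {ae (@lebesgue_measure R), forall t, S t}.
Proof.
move=> aeP aeQ PQS.
by apply: (@filterS2 _ _ (ae_filter_ringOfSetsType _) _ _ _ _ aeP aeQ).
Qed.

Lemma ae_imp (R : realType) (P S : R -> Prop) :
  {ae (@lebesgue_measure R), forall t, P t} ->
  (forall t, P t -> S t) -> {ae (@lebesgue_measure R), forall t, S t}.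
Proof. by move=> aeP PS; apply: (ae_imp2 aeP aeP) => t /PS. Qed.

Lemma abs_continuousS (R : realType) (a b c d : R) (h : R -> R) :
  a <= c -> d <= b -> abs_continuous a b h -> abs_continuous c d h.
Proof.
move=> ac db ach e /ach[r r0 hr]; exists r => // n x y xy; apply: hr => i.
by have [cx [xy' yd]] := xy i; split; [exact: le_trans cx|split=> //; exact: le_trans db].
Qed.

Lemma abs_continuous_unif (R : realType) (a b e : R) (h : R -> R) :
  abs_continuous a b h -> 0 < e -> exists2 d, 0 < d &
    forall x y, a <= x -> x <= b -> a <= y -> y <= b ->
      `|y - x| < d -> `|h y - h x| < e.
Proof.
move=> ach e0; have [d d0 hd] := abs_continuous_seq ach e0.
exists d => // x y.
wlog xy : x y / x <= y => [wl|] ax xb ay yb.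
  have [|yx] := leP x y; first by move/wl; apply.
  by rewrite distrC (distrC (h y)); apply: wl => //; exact: ltW.
move=> yxd; have := hd [:: (x, y)]; rewrite !big_seq1 /= => -> //.
  by rewrite ax xy yb.
by apply: le_lt_trans yxd; exact: ler_norm.
Qed.

Lemma abs_continuous_bounded (R : realType) (a b : R) (h : R -> R) :
  a <= b -> abs_continuous a b h ->
  exists2 M, 0 <= M & forall t, a <= t -> t <= b -> `|h t| <= M.
Proof.
move=> ab ach; have [d d0 hd] := abs_continuous_unif ach ltr01.
pose P c := exists2 M, 0 <= M & forall t, a <= t -> t <= c -> `|h t| <= M.
suff : P b by [].
apply: (@real_induction _ a b) => //.
  by exists `|h a| => // t ta tb; rewrite (_ : t = a)//; lra.
move=> s as_ sb; exists d => // x y ax xs sy yb dx yd [M M0 hM].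
exists (M + (`|h s| + 1)) => [|t at_ ty].
  by rewrite addr_ge0// addr_ge0.
have [tx|xt] := leP t x.
  by apply: (le_trans (hM _ at_ tx)); rewrite lerDl addr_ge0.
have := hd s t as_ sb at_ (le_trans ty yb).
have hts : `|t - s| < d by rewrite ltr_norml; lra.
move=> /(_ hts); have := ler_normD (h t - h s) (h s); rewrite subrK.
by move: M0; lra.
Qed.

(** All closure properties of absolute continuity used below come from
    bounding the increments of a function by those of two others. *)
Lemma abs_continuous_dom (R : realType) (a b C : R) (f g h : R -> R) :
  abs_continuous a b f -> abs_continuous a b g -> 0 <= C ->
  (forall x y, a <= x -> x <= y -> y <= b ->
     `|h y - h x| <= C * (`|f y - f x| + `|g y - g x|)) ->
  abs_continuous a b h.
Proof.
move=> acf acg C0 dom e e0.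
have C1 : 0 < C + 1 by lra.
have e1 : 0 < e / 2 / (C + 1) by rewrite !divr_gt0.
have [d d0 hd] := acf _ e1; have [r r0 hr] := acg _ e1.
exists (Num.min d r) => [|n x y xy tI]; first by rewrite lt_min d0.
rewrite lt_min => /andP[/(hd _ _ _ xy tI) hf /(hr _ _ _ xy tI) hg].
apply: (@le_lt_trans _ _
    ((C + 1) * (\sum_(i < n) `|f (y i) - f (x i)| + \sum_(i < n) `|g (y i) - g (x i)|))).
  rewrite -big_split mulr_sumr; apply: ler_sum => i _.
  have [ax [xyi yb]] := xy i; apply: le_trans (dom _ _ ax xyi yb) _.
  by rewrite ler_wpM2r ?addr_ge0//; lra.
rewrite -ltr_pdivlMl// mulrC; move: hf hg; rewrite mulrAC; lra.
Qed.

(** * Functions with a prescribed derivative almost everywhere *)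

Definition ac_deriv (R : realType) (t0 : R) (T : \bar R) (f f' : R -> R) : Prop :=
  loc_abs_continuous t0 T f /\
  {ae (@lebesgue_measure R), forall t, t0 <= t -> (t%:E < T)%E ->
     is_derive t 1 f (f' t)}.

Lemma is_solutionE (R : realType) (X Y : R -> R -> R -> R) (t1 : R)
    (t2 : \bar R) (phi psi : R -> R) :
  is_solution X Y t1 t2 phi psi <->
  [/\ (t1%:E < t2)%E, ac_deriv t1 t2 phi (fun t => X t (phi t) (psi t)) &
      ac_deriv t1 t2 psi (fun t => Y t (phi t) (psi t))].
Proof.
split=> [[t12 acx acy aexy]|[t12 [acx aex] [acy aey]]].
  by split=> //; split=> //; apply: (ae_imp aexy) => t H ? ?; case: H.
by split=> //; apply: (ae_imp2 aex aey) => t H1 H2 ? ?; split; [exact: H1|exact: H2].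
Qed.

Section ac_deriv.
Context {R : realType} (t0 : R) (T : \bar R).
Implicit Types f g : R -> R.

Lemma ac_derivS (T' : \bar R) f f' : (T' <= T)%E ->
  ac_deriv t0 T f f' -> ac_deriv t0 T' f f'.
Proof.
move=> TT [acf aef]; split=> [b tb bT|]; first exact/acf/(lt_le_trans bT).
by apply: (ae_imp aef) => t H tt tT; apply: H => //; exact: lt_le_trans TT.
Qed.

Lemma eq_ac_deriv f f' g' :
  (forall t, t0 <= t -> (t%:E < T)%E -> f' t = g' t) ->
  ac_deriv t0 T f f' -> ac_deriv t0 T f g'.
Proof.
move=> fg [acf aef]; split=> //.
by apply: (ae_imp aef) => t H tt tT; rewrite -fg//; exact: H.
Qed.

Lemma ac_deriv_cst (c : R) : ac_deriv t0 T (fun=> c) (fun=> 0).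
Proof.
split=> [b _ _ e e0|].
  exists 1 => // n x y _ _ _; rewrite big1 => // i _; by rewrite subrr normr0.
by apply: aeW => t _ _; exact: is_derive_cst.
Qed.

Lemma ac_derivD f f' g g' : ac_deriv t0 T f f' -> ac_deriv t0 T g g' ->
  ac_deriv t0 T (fun t => f t + g t) (fun t => f' t + g' t).
Proof.
move=> [acf aef] [acg aeg]; split=> [b tb bT|].
  apply: (@abs_continuous_dom _ _ _ 1 _ _ _ (acf _ tb bT) (acg _ tb bT)) => //.
  by move=> x y _ _ _; rewrite mul1r opprD addrACA ler_normD.
apply: (ae_imp2 aef aeg) => t Hf Hg tt tT.
by have hf := Hf tt tT; have hg := Hg tt tT; exact: (is_deriveD hf hg).
Qed.

Lemma ac_derivM f f' g g' : ac_deriv t0 T f f' -> ac_deriv t0 T g g' ->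
  ac_deriv t0 T (fun t => f t * g t) (fun t => f t * g' t + g t * f' t).
Proof.
move=> [acf aef] [acg aeg]; split=> [b tb bT|].
  have [F F0 hF] := abs_continuous_bounded tb (acf _ tb bT).
  have [G G0 hG] := abs_continuous_bounded tb (acg _ tb bT).
  apply: (@abs_continuous_dom _ _ _ (F + G) _ _ _ (acf _ tb bT) (acg _ tb bT)).
    exact: addr_ge0.
  move=> x y tx xy yb.
  have -> : f y * g y - f x * g x = g y * (f y - f x) + f x * (g y - g x) by ring.
  rewrite (le_trans (ler_normD _ _))// !normrM mulrDr.
  apply: lerD; apply: ler_wpM2r => //.
    by apply: le_trans (hG y _ yb) _; [exact: le_trans xy|rewrite lerDr].
  by apply: le_trans (hF x tx _) _; [exact: le_trans yb|rewrite lerDl].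
apply: (ae_imp2 aef aeg) => t Hf Hg tt tT.
by have hf := Hf tt tT; have hg := Hg tt tT; exact: (is_deriveM hf hg).
Qed.

Lemma ac_derivZ (c : R) f f' : ac_deriv t0 T f f' ->
  ac_deriv t0 T (fun t => c * f t) (fun t => c * f' t).
Proof.
move=> Hf; apply: eq_ac_deriv (ac_derivM (ac_deriv_cst c) Hf) => t _ _.
by rewrite mulr0 addr0.
Qed.

Lemma ac_derivN f f' : ac_deriv t0 T f f' ->
  ac_deriv t0 T (fun t => - f t) (fun t => - f' t).
Proof.
move=> Hf; have := ac_derivZ (-1) Hf.
under eq_fun do rewrite mulN1r.
by under [X in ac_deriv _ _ _ X]eq_fun do rewrite mulN1r.
Qed.

Lemma ac_derivB f f' g g' : ac_deriv t0 T f f' -> ac_deriv t0 T g g' ->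
  ac_deriv t0 T (fun t => f t - g t) (fun t => f' t - g' t).
Proof. by move=> Hf /ac_derivN; exact: ac_derivD. Qed.

Lemma ac_deriv_sum n (f f' : 'I_n -> R -> R) :
  (forall i, ac_deriv t0 T (f i) (f' i)) ->
  ac_deriv t0 T (fun t => \sum_(i < n) f i t) (fun t => \sum_(i < n) f' i t).
Proof.
elim: n f f' => [|n IH] f f' Hf.
  under eq_fun do rewrite big_ord0.
  under [X in ac_deriv _ _ _ X]eq_fun do rewrite big_ord0.
  exact: ac_deriv_cst.
under eq_fun do rewrite big_ord_recl.
under [X in ac_deriv _ _ _ X]eq_fun do rewrite big_ord_recl.
by apply: ac_derivD => //; exact: IH.
Qed.

Lemma ac_deriv_comp (phi phi' : R -> R) f f' :
  (forall x : R, is_derive x 1 phi (phi' x)) ->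
  (forall M, exists2 C, 0 <= C & forall x y, `|x| <= M -> `|y| <= M ->
     `|phi y - phi x| <= C * `|y - x|) ->
  ac_deriv t0 T f f' ->
  ac_deriv t0 T (fun t => phi (f t)) (fun t => phi' (f t) * f' t).
Proof.
move=> dphi lphi [acf aef]; split=> [b tb bT|].
  have [F F0 hF] := abs_continuous_bounded tb (acf _ tb bT).
  have [C C0 hC] := lphi F.
  apply: (@abs_continuous_dom _ _ _ C _ _ _ (acf _ tb bT) (acf _ tb bT)) => //.
  move=> x y tx xy yb; apply: le_trans (hC _ _ _ _) _.
  - by apply: hF => //; exact: le_trans yb.
  - by apply: hF => //; exact: le_trans xy.
  - by rewrite ler_wpM2l// lerDl.
apply: (ae_imp aef) => t Hf tt tT.
by have hf := Hf tt tT; exact: (is_derive1_comp (dphi (f t)) hf).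
Qed.

Lemma ac_deriv_expR f f' : ac_deriv t0 T f f' ->
  ac_deriv t0 T (fun t => expR (f t)) (fun t => expR (f t) * f' t).
Proof.
apply: ac_deriv_comp => M.
exists (expR M) => [|x y]; first exact: expR_ge0.
wlog xy : x y / x <= y => [wl xM yM|].
  have [xy|/ltW yx] := leP x y; first exact: wl.
  by rewrite distrC (distrC y); exact: wl.
move=> xM yM; rewrite !ger0_norm ?subr_ge0 ?ler_expR//.
apply: (@le_trans _ _ (expR y * (y - x))).
  have -> : expR y - expR x = expR y * (1 - expR (x - y)).
    by rewrite mulrBr mulr1 -expRD (_ : y + (x - y) = x) //; ring.
  rewrite ler_wpM2l ?expR_ge0//.
  by have := expR_ge1Dx (x - y); lra.
rewrite ler_wpM2r ?subr_ge0// ler_expR.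
exact: le_trans (ler_norm y) yM.
Qed.

(** The square of the positive part is used in place of the positive part
    because it is differentiable, at [0] too. *)
Lemma ac_deriv_sqp f f' : ac_deriv t0 T f f' ->
  ac_deriv t0 T (fun t => Num.max (f t) 0 ^+ 2)
    (fun t => 2 * Num.max (f t) 0 * f' t).
Proof.
apply: (@ac_deriv_comp (fun x => Num.max x 0 ^+ 2) (fun x => 2 * Num.max x 0)).
  move=> x; apply: is_derive_from_near => e e0; exists e => // y yx.
  apply: (@le_trans _ _ (`|y - x| ^+ 2)).
    rewrite real_normK ?num_real// ler_norml.
    have := sqr_ge0 (y - x).
    by case: (leP x 0); case: (leP y 0) => y0 x0 yx0; apply/andP; split; nra.
  by rewrite expr2 ler_wpM2r// ltW.
move=> M; exists (2 * `|M|) => [|x y xM yM]; first by rewrite mulr_ge0.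
have maxle (z : R) : `|z| <= M -> Num.max z 0 <= `|M|.
  move=> zM; rewrite ge_max normr_ge0 andbT.
  by rewrite (le_trans (ler_norm z))// (le_trans zM)// ler_norm.
have max0 (z : R) : 0 <= Num.max z 0 by rewrite le_max lexx orbT.
rewrite subr_sqr mulrC normrM; apply: ler_pM => //.
  by rewrite ger0_norm ?addr_ge0//; have := maxle _ xM; have := maxle _ yM; lra.
rewrite ler_norml; have := ler_norm (y - x); have := ler_norm (x - y).
rewrite (distrC x y); case: (leP x 0); case: (leP y 0) => *; apply/andP; split; lra.
Qed.

End ac_deriv.

(** * Differential inequalities *)

Section ac_deriv_order.
Context {R : realType} (t0 : R) (T : \bar R).
Implicit Types f g : R -> R.

Lemma ac_deriv_nondecreasing f f' a b : ac_deriv t0 T f f' ->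
  t0 <= a -> a <= b -> (b%:E < T)%E ->
  (forall t, a <= t -> t <= b -> 0 <= f' t) -> f a <= f b.
Proof.
move=> [acf aef] ta ab bT f'0; apply: (ac_nondecreasing ab).
  by apply: (abs_continuousS ta (lexx b)); apply: acf => //; exact: le_trans ab.
apply: (ae_imp aef) => t Ht at_ tb; exists (f' t); last exact: f'0.
by apply: Ht; [exact: le_trans at_|apply: le_lt_trans bT; rewrite lee_fin].
Qed.

Lemma ac_deriv_dominated f f' g g' a b : ac_deriv t0 T f f' ->
  ac_deriv t0 T g g' -> t0 <= a -> a <= b -> (b%:E < T)%E ->
  (forall t, a <= t -> t <= b -> `|f' t| <= g' t) ->
  `|f b - f a| <= g b - g a.
Proof.
move=> acf acg ta ab bT fg; rewrite ler_norml; apply/andP; split.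
  have := ac_deriv_nondecreasing (ac_derivD acg acf) ta ab bT.
  have H t : a <= t -> t <= b -> 0 <= g' t + f' t.
    by move=> at_ tb; have := fg _ at_ tb; rewrite ler_norml => /andP[]; lra.
  by move=> /(_ H); lra.
have := ac_deriv_nondecreasing (ac_derivB acg acf) ta ab bT.
have H t : a <= t -> t <= b -> 0 <= g' t - f' t.
  by move=> at_ tb; have := fg _ at_ tb; rewrite ler_norml => /andP[]; lra.
by move=> /(_ H); lra.
Qed.

(** The function [f * expR (- J)] has a nonpositive derivative. *)
Lemma gronwall f f' J k b : ac_deriv t0 T f f' -> ac_deriv t0 T J k ->
  t0 <= b -> (b%:E < T)%E ->
  (forall t, t0 <= t -> t <= b -> f' t <= k t * f t) ->
  f b <= f t0 * expR (J b - J t0).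
Proof.
move=> acf acJ tb bT fk.
have acE := ac_derivN (ac_derivM acf (ac_deriv_expR (ac_derivN acJ))).
have := ac_deriv_nondecreasing acE (lexx _) tb bT.
have H t : t0 <= t -> t <= b ->
    0 <= - (f t * (expR (- J t) * - k t) + expR (- J t) * f' t).
  move=> tt tb'; rewrite oppr_ge0.
  have -> : f t * (expR (- J t) * - k t) + expR (- J t) * f' t =
    expR (- J t) * (f' t - k t * f t) by ring.
  by rewrite mulr_ge0_le0 ?expR_ge0// subr_le0; exact: fk.
move=> /(_ H); rewrite lerN2 => h.
rewrite -(@ler_pM2r _ (expR (- J b))) ?expR_gt0// (le_trans h)//.
by rewrite -mulrA -expRD addrAC subrr add0r.
Qed.

(** If a component [w i] grows only through the positive parts of the others,
    the orthant where all the [w i] are nonpositive cannot be left: the sum of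
    the squares of the positive parts vanishes at [t0] and satisfies the
    hypothesis of Gronwall's lemma, by the Cauchy-Schwarz inequality. *)
Lemma quasimonotone_le0 n (w w' : 'I_n -> R -> R) J k b :
  (forall i, ac_deriv t0 T (w i) (w' i)) -> ac_deriv t0 T J k ->
  t0 <= b -> (b%:E < T)%E ->
  (forall i, w i t0 <= 0) ->
  (forall i t, t0 <= t -> t <= b -> 0 < w i t ->
     w' i t <= k t * \sum_(j < n) Num.max (w j t) 0) ->
  (forall t, t0 <= t -> t <= b -> 0 <= k t) ->
  forall i, w i b <= 0.
Proof.
move=> acw acJ tb bT w0 wk k0.
have acV := ac_deriv_sum (fun i => ac_deriv_sqp (acw i)).
(* The factor 2 comes from the squares and [n] from Cauchy-Schwarz. *)
have acJ2 := ac_derivZ (2 * n%:R) acJ.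
have := gronwall acV acJ2 tb bT.
have H t : t0 <= t -> t <= b ->
  \sum_(i < n) 2 * Num.max (w i t) 0 * w' i t <=
    2 * n%:R * k t * \sum_(i < n) Num.max (w i t) 0 ^+ 2.
  move=> tt tb'; pose m i := Num.max (w i t) 0.
  have m0 i : 0 <= m i by rewrite le_max lexx orbT.
  have CS : (\sum_i m i) * (\sum_i m i) <= n%:R * \sum_i m i ^+ 2.
    rewrite big_distrlr/=.
    apply: (@le_trans _ _ (\sum_i \sum_j (m i ^+ 2 + m j ^+ 2) / 2)).
      apply: ler_sum => i _; apply: ler_sum => j _.
      by have := sqr_ge0 (m i - m j); rewrite sqrrB; lra.
    rewrite (eq_bigr (fun i => n%:R / 2 * m i ^+ 2 + (\sum_j m j ^+ 2) / 2)).
      rewrite big_split/= -mulr_sumr sumr_const card_ord -mulr_natl.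
      by rewrite le_eqVlt; apply/orP; left; apply/eqP; field.
    move=> i _; rewrite -mulr_suml big_split/= sumr_const card_ord -mulr_natl.
    by field.
  apply: (@le_trans _ _ (\sum_i 2 * k t * (m i * \sum_j m j))).
    apply: ler_sum => i _; rewrite -/(m i).
    have [wi|wi] := ltP 0 (w i t).
      have := wk i t tt tb' wi; rewrite -/(\sum_j m j) => /(ler_wpM2l (m0 i)).
      by lra.
    by rewrite /m max_r// mulr0 !mul0r mulr0.
  rewrite -mulr_sumr -mulr_suml.
  have := ler_wpM2l (k0 _ tt tb') CS; rewrite -/m; lra.
move=> /(_ H) {H}.
rewrite [X in _ <= X * _]big1 ?mul0r => [V0 i|i _]; last first.
  by rewrite max_r// expr0n.
have : Num.max (w i b) 0 ^+ 2 <= 0.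
  apply: le_trans V0; rewrite (bigD1 i)//= lerDl sumr_ge0// => j _.
  exact: sqr_ge0.
have [//|wi] := leP (w i b) 0.
by rewrite leNgt exprn_gt0.
Qed.

End ac_deriv_order.

(** * Primitives for the completed Lebesgue measure *)

Notation completedR R := (caratheodory_type (wlength (@idfun R))^*%mu).

Lemma completed_measurableE (R : realType) (A : set R) :
  @measurable _ (completedR R) A <->
  exists2 B : set R, measurable B & exists2 N : set R,
    (@lebesgue_measure R).-negligible N & B `|` N = A.
Proof.
have -> : @measurable _ (completedR R) A =
  completed_algebra_gen (@lebesgue_measure R) A.
  rewrite -g_sigma_completed_algebra_genE.
  by rewrite completed_caratheodory_measurable.
by split=> [[B mB [N nN <-]]|[B mB [N nN <-]]]; exists B => //; exists N.
Qed.

Lemma borel_completed (R : realType) (A : set R) :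
  measurable A -> @measurable _ (completedR R) A.
Proof.
move=> mA; apply/completed_measurableE; exists A => //.
by exists set0; [exact: negligible_set0|rewrite setU0].
Qed.

(** A Lebesgue measurable function is Borel after it is set to [0] on a Borel
    null set: each of the countably many sets [f > q], with [q] rational, is
    Borel up to such a set. *)
Lemma completed_borel_version (R : realType) (f : R -> R) :
  @measurable_fun _ _ (completedR R) R setT f ->
  exists N : set R, [/\ measurable N, @lebesgue_measure R N = 0%E &
     measurable_fun setT (f \_ (~` N))].
Proof.
move=> mf.
have H (q : rat) : exists N : set R, [/\ measurable N, @lebesgue_measure R N = 0%E &
    measurable (~` N `&` f @^-1` `]ratr q, +oo[)].
  have /completed_measurableE[B mB [M [N [mN N0 MN]] BM]] :
      @measurable _ (completedR R) (f @^-1` `]ratr q, +oo[).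
    by rewrite -[X in measurable X]setTI; apply: mf => //.
  exists N; split => //; rewrite -BM setIUr.
  have -> : ~` N `&` M = set0.
    by rewrite -subset0 => x [/= nNx /MN].
  by rewrite setU0; apply: measurableI => //; exact: measurableC.
have [N HN] := choice H.
(* The rationals are enumerated to take a countable union. *)
pose Nn n := if @unpickle rat n is Some q then N q else set0.
have mNn n : measurable (Nn n).
  by rewrite /Nn; case: unpickle => // q; have [] := HN q.
have Nn0 n : @lebesgue_measure R (Nn n) = 0%E.
  rewrite /Nn; case: unpickle => [q|]; last exact: measure0.
  by have [] := HN q.
have mN : measurable (\bigcup_n Nn n) by exact: bigcupT_measurable.
exists (\bigcup_n Nn n); split => //.
  apply: measure_negligible => //; apply: negligible_bigcup => n.
  by exists (Nn n); split; [exact: mNn|exact: Nn0|].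
apply/(measurable_restrictT _ _).1; first exact: measurableC.
apply: (measurability _ (RGenOInfty.measurableE R)) => //.
move=> _ [_ [c ->] <-].
have -> : ~` (\bigcup_n Nn n) `&` f @^-1` `]c, +oo[ =
  \bigcup_(q : rat) (if c < ratr q then 
     (~` (\bigcup_n Nn n) `&` (~` N q `&` f @^-1` `]ratr q, +oo[)) else set0).
  apply/seteqP; split=> [x [nx /=]|x [q _]].
    rewrite in_itv/= andbT => /rat_in_itvoo[q]; rewrite in_itv/= => /andP[cq qf].
    exists q => //=; rewrite cq; split => //; split; last by rewrite /= in_itv/= qf.
    have NqE : Nn (pickle q) = N q by rewrite /Nn pickleK.
    by move=> Nx; apply: nx; exists (pickle q); [exact: I|rewrite NqE].
  case: ifPn => // cq [nx [_ /=]]; rewrite in_itv/= andbT => qf.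
  by split => //=; rewrite in_itv/= andbT; exact: lt_trans qf.
apply: bigcupT_measurable_rat => q; case: ifPn => // _.
apply: measurableI; first exact: measurableC.
by have [] := HN q.
Qed.

(** Absolute continuity of the integral gives local absolute continuity; the
    derivative comes from the Lebesgue differentiation theorem. As [g] vanishes
    before [t0], integrating from [t0] or from minus infinity is the same. *)
Lemma borel_primitive (R : realType) (t0 : R) (g : R -> R) :
  measurable_fun setT g ->
  (forall b, (@lebesgue_measure R).-integrable `[t0, b] (EFin \o g)) ->
  (forall t, t < t0 -> g t = 0) ->
  ac_deriv t0 +oo%E (fun t => \int[@lebesgue_measure R]_(s in `[t0, t]) g s) g.
Proof.
move=> mg ig g0; split=> [b tb _ e e0|].
- pose g1 := g \_ `[t0, b].
  have ig1 : (@lebesgue_measure R).-integrable setT (EFin \o g1).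
    by rewrite -restrict_EFin; apply/(integrable_mkcond _ _).1.
  have [d [d0 hd]] := integral_normr_continuous ig1 e0.
  exists d => // n x y xy tI sd.
  pose F (i : 'I_n) : set (measurableTypeR R) := `]x i, y i[%classic.
  pose A := \big[setU/set0]_(i < n) F i.
  have mF i : measurable (F i) by exact: measurable_itv.
  have mA : measurable A by apply: bigsetU_measurable => i _.
  have lF i : @lebesgue_measure R (F i) = (y i - x i)%:E.
    rewrite /F lebesgue_measure_itv/= lte_fin; case: ltP => // yx.
    by congr (_%:E); have [_ [? _]] := xy i; lra.
  have muA : (@lebesgue_measure R A < d%:E)%E.
    rewrite /A measure_bigsetU_ord//.
    by rewrite (eq_bigr (fun i => (y i - x i)%:E)) ?sumEFin ?lte_fin// => i _; exact: lF.
  have iA : (@lebesgue_measure R).-integrable A (EFin \o (fun t => `|g1 t|)).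
    apply: (@integrableS _ _ _ _ setT) => //.
    exact: (integrable_norm ig1).
  have := hd A mA muA; rewrite -lte_fin /Rintegral fineK; last first.
    by apply: integrable_fin_num.
  rewrite integral_bigsetU_EFin//=; last 3 first.
  - exact: index_enum_uniq.
  - by apply: sub_trivIset tI.
  - by case/integrableP : iA.
  rewrite -lte_fin; apply: le_lt_trans.
  rewrite -sumEFin; apply: lee_sum => i _; have [tx [xyi yb]] := xy i.
  have iF : (@lebesgue_measure R).-integrable (F i) (EFin \o g1).
    exact: (integrableS measurableT (mF i) (@subsetT _ _) ig1).
  have -> : \int[@lebesgue_measure R]_(s in `[t0, y i]) g s -
      \int[@lebesgue_measure R]_(s in `[t0, x i]) g s =
      \int[@lebesgue_measure R]_(s in F i) g1 s.
    rewrite Rintegral_itvB//=.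
    rewrite -Rintegral_itv_bndo_bndc; last first.
      apply: integrableS (ig (y i)) => //=.
      by move=> s /=; rewrite !in_itv/= => /andP[? ?]; apply/andP; split; lra.
    apply: eq_Rintegral => s; rewrite inE/= in_itv/= => /andP[xs sy].
    rewrite /g1 patchE mem_set//= in_itv/=; apply/andP; split; lra.
  rewrite EFin_normr_Rintegral//; apply: le_abse_integral => //.
  by case/integrableP : iF.
- have gE y : (EFin \o g) \_ `]-oo, y] = (EFin \o g) \_ `[t0, y].
    apply/funext => t; rewrite !patchE; case: ifPn; case: ifPn => //=.
      rewrite notin_setE/= !in_itv/= inE/= in_itv/=.
      by move=> /negP + ty; rewrite ty andbT -ltNge => /g0 ->.
    rewrite notin_setE/= inE/= !in_itv/=.
    by move=> /andP[_ ->].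
  have ig' y : (@lebesgue_measure R).-integrable `]-oo, y] (EFin \o g).
    apply/integrable_mkcond => //=; rewrite gE.
    by apply/(integrable_mkcond _ _).1 => //=; exact: ig.
  have locg : locally_integrable setT g.
    split => //; first exact: openT.
    move=> K _ cK; have [M [_ HM]] := compact_bounded cK.
    pose M1 := `|M| + 1.
    have KM : K `<=` `]-oo, M1].
      move=> t Kt /=; rewrite in_itv/=; apply: (le_trans (ler_norm _)).
      by apply: (HM M1) => //; rewrite /M1; have := ler_norm M; lra.
    apply: (@le_lt_trans _ _ (\int[@lebesgue_measure R]_(x in `]-oo, M1]) `|g x|%:E)%E).
      apply: ge0_subset_integral => //=; first exact: compact_measurable.
      apply/measurable_EFinP/measurableT_comp => //=.
      exact: measurable_funS mg.
    by have /integrableP[] := ig' M1.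
  have -> : (fun t => \int[@lebesgue_measure R]_(s in `[t0, t]) g s) =
      (fun t => \int[@lebesgue_measure R]_(s in `]-oo, t]) g s).
    by apply/funext => t; rewrite /Rintegral integral_mkcond [in RHS]integral_mkcond gE.
  move: (FTC1Ny ig' locg) => /ae_imp; apply=> t [dF dFE] tt _.
  by split; [exact: dF|rewrite -derive1E; exact: dFE].
Qed.

(** The identity pushes the completed measure forward to the Borel one, so that
    a Borel version of [k] has the same integrals for both. *)
Lemma loc_integrable_borel (R : realType) (t0 : R) (k : R -> R) :
  loc_integrable t0 k -> exists g : R -> R,
  [/\ measurable_fun setT g,
     (forall b, (@lebesgue_measure R).-integrable `[t0, b] (EFin \o g)),
     (forall t, t < t0 -> g t = 0),
     (forall t, \int[@completed_lebesgue_measure R]_(s in `[t0, t]) k s =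
        \int[@lebesgue_measure R]_(s in `[t0, t]) g s) &
     {ae (@lebesgue_measure R), forall t, t0 <= t -> g t = k t}].
Proof.
move=> ik.
pose f : R -> R := k \_ `[t0, +oo[.
have mf : @measurable_fun _ _ (completedR R) R setT f.
  have mt0 : @measurable _ (completedR R) `[t0, +oo[.
    by apply: borel_completed.
  apply/(measurable_restrictT _ _).1 => //.
  rewrite (_ : `[t0, +oo[%classic = \bigcup_n `[t0, t0 + n%:R]%classic); last first.
    apply/seteqP; split=> [t /=|t [n _] /=]; rewrite !in_itv/= ?andbT => tt.
      exists (Num.truncn (t - t0)).+1 => //=; rewrite in_itv/= tt/=.
      rewrite -lerBlDl; apply/ltW/truncnS_gt.
    by case/andP : tt.
  apply/measurable_fun_bigcup => n; first exact: borel_completed.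
  by have /integrableP[/measurable_EFinP] := ik (t0 + n%:R).
have [N [mN N0 mg]] := completed_borel_version mf.
pose g : R -> R := f \_ (~` N).
have fle t : `|f t| <= `|k t|.
  by rewrite /f patchE; case: ifPn => //; rewrite normr0.
have gle t : `|g t| <= `|k t|.
  by apply: le_trans (fle t); rewrite /g patchE; case: ifPn => //; rewrite normr0.
have mgc D : @measurable_fun _ _ (completedR R) R D g.
  move=> mD A mA; apply: measurableI => //.
  by have := borel_completed (mg measurableT _ mA); rewrite setTI.
have igc b : (@completed_lebesgue_measure R).-integrable `[t0, b] (EFin \o g).
  apply: le_integrable (ik b) => //=; first exact: borel_completed.
    by apply/measurable_EFinP; exact: mgc.
  by move=> t _; rewrite lee_fin.
pose toR : completedR R -> measurableTypeR R := @idfun R.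
have mid : measurable_fun setT toR.
  by move=> _ A mA; rewrite setTI; exact: borel_completed.
have mgE : @measurable_fun _ _ (measurableTypeR R) _ setT (EFin \o g).
  by apply/measurable_EFinP; exact: mg.
have mitv b : @measurable _ (measurableTypeR R) `[t0, b] by exact: measurable_itv.
have muE (A : set (measurableTypeR R)) :
  pushforward (@completed_lebesgue_measure R) toR A = @lebesgue_measure R A by [].
exists g; split => //.
- move=> b; have /integrableP[mgb ib] := integrable_pushforward mid mgE (igc b) (mitv b).
  apply/integrableP; split => //.
- move=> t tt; rewrite /g /f !patchE; case: ifPn => // _.
  by case: ifPn => //; rewrite inE/= in_itv/= andbT leNgt tt.
- move=> t; rewrite /Rintegral; congr fine.
  transitivity (\int[@completed_lebesgue_measure R]_(s in `[t0, t]) (g s)%:E)%E.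
    apply: ae_eq_integral.
    - exact: borel_completed.
    - by have /integrableP[] := ik t.
    - by have /integrableP[] := igc t.
    - exists N; split => //; first exact: borel_completed.
      move=> s /= /not_implyP[]; rewrite in_itv/= => /andP[ts st] kg.
      apply: contrapT => Ns; apply: kg.
      by rewrite /g /f !patchE mem_set// mem_set//= in_itv/= ts.
  rewrite -(integral_pushforward mid mgE (igc t) (mitv t)).
  by apply: eq_measure_integral => A _ _; exact: muE.
- exists N; split => // s /= /not_implyP[ts gk].
  apply: contrapT => Ns; apply: gk.
  by rewrite /g /f !patchE mem_set// mem_set//= in_itv/= ts.
Qed.

Lemma loc_integrable_primitive (R : realType) (t0 : R) (k : R -> R) :
  loc_integrable t0 k ->
  ac_deriv t0 +oo%E
    (fun t => \int[@completed_lebesgue_measure R]_(s in `[t0, t]) k s) k.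
Proof.
move=> /loc_integrable_borel[g [mg ig g0 Ig gk]].
have [acg aeg] := borel_primitive mg ig g0.
rewrite (_ : (fun _ => _) = fun t => \int[@lebesgue_measure R]_(s in `[t0, t]) g s).
  split=> //; apply: (ae_imp2 aeg gk) => t H1 H2 tt too.
  by rewrite -H2//; exact: H1.
exact/funext.
Qed.

(** * Functions measurable in time and continuous in space *)

(** The arguments [x] and [y] are rounded down to multiples of [1 / n.+1]. On
    each of the countably many pieces where the rounded values are constant
    the measurability in [t] at fixed [u], [v] applies; continuity in [(u, v)]
    then gives the limit. *)
Lemma caratheodory_comp_measurable (R : realType) (d : measure_display)
    (T : measurableType d) (D : set T) (X : T -> R -> R -> R) (x y : T -> R) :
  measurable D -> measurable_fun D x -> measurable_fun D y ->
  (forall u v, measurable_fun D (fun t => X t u v)) ->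
  (forall t, D t -> continuous (fun z : R * R => X t z.1 z.2)) ->
  measurable_fun D (fun t => X t (x t) (y t)).
Proof.
move=> mD mx my mX cX.
pose rd (n : nat) (r : R) : R := (Num.floor (r * n.+1%:R))%:~R / n.+1%:R.
have rdP n r : rd n r <= r < rd n r + n.+1%:R^-1.
  have n0 : 0 < n.+1%:R :> R by rewrite ltr0n.
  have := floor_itv (r * n.+1%:R); rewrite intrD => /andP[h1 h2].
  rewrite /rd ler_pdivrMr// h1/= -[X in _ + X]mul1r -mulrDl ltr_pdivlMr//.
have rdcvg r : rd n r @[n --> \oo] --> r.
  apply/cvgrPdist_lt => e e0; near=> n.
  have := rdP n r => /andP[h1 h2].
  rewrite ger0_norm ?subr_ge0// ltrBlDr addrC (lt_trans h2)// ltrD2l.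
  near: n; exact: near_infty_natSinv_lt (PosNum e0).
apply: (@measurable_fun_cvg _ _ _ _ (fun n t => X t (rd n (x t)) (rd n (y t)))).
  move=> n; pose E (k : nat) : set T :=
    if @unpickle (int * int)%type k is Some ij then
      (D `&` x @^-1` `[ij.1%:~R / n.+1%:R, (ij.1 + 1)%:~R / n.+1%:R[) `&`
      (D `&` y @^-1` `[ij.2%:~R / n.+1%:R, (ij.2 + 1)%:~R / n.+1%:R[)
    else set0.
  have rdE r (i : int) : `[i%:~R / n.+1%:R, (i + 1)%:~R / n.+1%:R[%classic r ->
      rd n r = i%:~R / n.+1%:R.
    rewrite /= in_itv/= ler_pdivrMr ?ltr_pdivlMr ?ltr0n// => h.
    by rewrite /rd (floor_def h).
  have -> : D = \bigcup_k E k.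
    apply/seteqP; split => [t Dt|t [k _]]; rewrite /E/=.
      exists (pickle (Num.floor (x t * n.+1%:R), Num.floor (y t * n.+1%:R))).
        exact: I.
      rewrite pickleK /=.
      by split; split; rewrite ?in_itv/= ?ler_pdivrMr ?ltr_pdivlMr ?ltr0n ?floor_itv.
    by case: unpickle => // ij [[]].
  have mE k : measurable (E k).
    rewrite /E; case: unpickle => // ij.
    by apply: measurableI; [exact: mx|exact: my].
  apply/measurable_fun_bigcup => // k; rewrite /E.
  case: unpickle => [[i j]|]; last exact: measurable_fun_set0.
  apply: (@eq_measurable_fun _ _ _ _ _ (fun t => X t (i%:~R / n.+1%:R) (j%:~R / n.+1%:R))).
    by move=> t; rewrite inE/= => -[[_ ti] [_ tj]]; rewrite (rdE _ _ ti) (rdE _ _ tj).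
  by apply: measurable_funS (mX _ _) => // t [[]].
move=> t Dt.
exact: (@cvg_comp2 _ _ _ _ _ _ _ _ _ _ _ _ _ (X t) (rdcvg (x t)) (rdcvg (y t))
  (cX t Dt (x t, y t))).
Unshelve. all: by end_near. Qed.

(** A version of the Arzela-Ascoli theorem on a half-line. The limit is taken
    pointwise along one ultrafilter on [nat]; equicontinuity makes this
    convergence uniform on each compact interval, and a subsequence can then be
    chosen by picking one index for each interval. *)
Lemma equicontinuous_subsequence (R : realType) (t0 : R) (z : nat -> R -> R) :
  (forall t, t0 <= t -> exists B : R, forall n, `|z n t| <= B) ->
  (forall t e : R, t0 <= t -> 0 < e -> exists2 d : R, 0 < d & forall n t',
     t0 <= t' -> `|t' - t| < d -> `|z n t' - z n t| <= e) ->
  exists (sg : nat -> nat) (l : R -> R), (forall k, (k <= sg k)%N) /\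
    forall k t, t0 <= t -> t <= t0 + k%:R -> `|z (sg k) t - l t| <= k.+1%:R^-1.
Proof.
move=> bz ez.
have [U [UU oU]] := ultraFilterLemma (@eventually_filter).
have FU : ProperFilter U := @ultra_proper _ _ UU.
have lim t : t0 <= t -> exists l : R, z ^~ t @ U --> l.
  move=> tt; have [B HB] := bz t tt.
  have zB n : `[-B, B]%classic (z n t) by rewrite /= in_itv/= -ler_norml.
  have FB : (z ^~ t @ U) `[- B, B]%classic.
    exact: (@filterS _ U _ setT _ (fun n _ => zB n) filterT).
  have [p [_ clp]] := @segment_compact R (- B) B (z ^~ t @ U) _ FB.
  exists p => V Vp; have [//|nV] := in_ultra_setVsetC ((z^~ t) @^-1` V) UU.
  by have [r [nVr /nVr]] := clp (~` V) V nV Vp.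
pose l t : R := if pselect (t0 <= t) is left ht then sval (cid (lim t ht)) else 0.
have zl t : t0 <= t -> z ^~ t @ U --> l t.
  by move=> tt; rewrite /l; case: pselect => // tt'; case: cid.
have le (t e d : R) : t0 <= t -> 0 < e ->
    (forall n t', t0 <= t' -> `|t' - t| < d -> `|z n t' - z n t| <= e) ->
    forall t', t0 <= t' -> `|t' - t| < d -> `|l t' - l t| <= e.
  move=> tt e0 H t' tt' td.
  have cv : `|z n t' - z n t| @[n --> U] --> `|l t' - l t|.
    by apply: cvg_norm; apply: cvgB; exact: zl.
  apply: (@closed_cvg _ _ _ FU _ _ (@closed_le R e) _ _ cv).
  exact: (@filterS _ U _ setT _ (fun n _ => H n t' tt' td) filterT).
have unif k : U [set n | forall t, `[t0, t0 + k%:R]%classic t -> `|z n t - l t| <= k.+1%:R^-1].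
  pose P n t := `|z n t - l t| <= k.+1%:R^-1.
  have /compact_near_coveringP/near_covering_withinP := @segment_compact R t0 (t0 + k%:R).
  move=> /(_ nat U P _); apply => t; rewrite /= in_itv/= => /andP[tt _].
  pose e : R := k.+1%:R^-1 / 3.
  have e0 : 0 < e by rewrite divr_gt0// invr_gt0 ltr0n.
  have [d d0 hd] := ez t e tt e0.
  have : \forall n \near U, `|l t - z n t| < e.
    by move/cvgrPdist_lt : (zl t tt); apply.
  have : \forall t' \near t, `|t' - t| < d.
    by near=> t'; rewrite distrC; near: t'; exact: (nbhsx_ballx t d d0).
  move=> H1 H2; exists ([set t' | `|t' - t| < d], [set n | `|l t - z n t| < e]) => //=.
  move=> [t' n] [/= td nl]; rewrite in_itv/= => /andP[tt' _].
  rewrite /P; have := hd n t' tt' td; have := le t e d tt e0 hd t' tt' td.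
  have -> : k.+1%:R^-1 = e + e + e by rewrite /e; field; rewrite nat1r pnatr_eq0.
  move=> h1 h2; have -> : z n t' - l t' = (z n t' - z n t) - (l t' - l t) - (l t - z n t) by ring.
  rewrite (le_trans (ler_normB _ _))// lerD ?(ltW nl)//.
  by rewrite (le_trans (ler_normB _ _))// lerD.
have sgP k : exists n, (k <= n)%N /\
    forall t, `[t0, t0 + k%:R]%classic t -> `|z n t - l t| <= k.+1%:R^-1.
  have : U ([set n | (k <= n)%N] `&`
      [set n | forall t, `[t0, t0 + k%:R]%classic t -> `|z n t - l t| <= k.+1%:R^-1]).
    apply: filterI => //; apply: oU; exact: nbhs_infty_ge.
  by move=> /filter_ex[n [kn H]]; exists n.
have [sg Hsg] := choice sgP.
exists sg, l; split=> [k|k t tt tk]; first by have [] := Hsg k.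
by have [_] := Hsg k; apply; rewrite /= in_itv/= tt.
Unshelve. all: by end_near. Qed.

Lemma normr_maxB_le (R : realDomainType) (a s t : R) :
  `|Num.max a s - Num.max a t| <= `|s - t|.
Proof.
rewrite ler_norml; have := ler_norm (s - t); have := ler_norm (t - s).
rewrite (distrC t s).
by case: (leP a s) => ?; case: (leP a t) => ? ? ?; apply/andP; split; lra.
Qed.

Lemma normr_minB_le (R : realDomainType) (b s t : R) :
  `|Num.min s b - Num.min t b| <= `|s - t|.
Proof.
rewrite ler_norml; have := ler_norm (s - t); have := ler_norm (t - s).
rewrite (distrC t s).
by case: (leP s b) => ?; case: (leP t b) => ? ? ?; apply/andP; split; lra.
Qed.

Lemma continuous_clamp (R : realType) (a b : R) (h : R -> R) :
  a <= b -> abs_continuous a b h ->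
  continuous (fun t => h (Num.max a (Num.min t b))).
Proof.
move=> ab ach t; apply/cvgrPdist_lt => e e0.
have [d d0 hd] := abs_continuous_unif ach e0.
have cl s : a <= Num.max a (Num.min s b) <= b.
  by rewrite le_max lexx ge_max ab ge_min lexx orbT.
near=> s; have /andP[? ?] := cl s; have /andP[? ?] := cl t.
apply: hd => //.
have std : `|s - t| < d by rewrite distrC; near: s; exact: (nbhsx_ballx t d d0).
apply: le_lt_trans std; rewrite distrC.
apply: (@le_trans _ _ `|Num.min s b - Num.min t b|).
  exact: normr_maxB_le.
exact: normr_minB_le.
Unshelve. all: by end_near. Qed.

Definition cmeasurable (R : realType) (t0 : R) (x : R -> R) : Prop :=
  forall b, @measurable_fun _ _ (completedR R) R `[t0, b] x.

Lemma continuous_cmeasurable (R : realType) (t0 : R) (x : R -> R) :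
  continuous x -> cmeasurable t0 x.
Proof.
move=> cx b; have mx := continuous_measurable_fun cx.
move=> mD A mA; apply: measurableI => //.
by have := borel_completed (mx measurableT _ mA); rewrite setTI.
Qed.

Lemma delay_cmeasurable (R : realType) (t0 d : R) (x : R -> R) :
  0 <= d -> (forall b, t0 <= b -> abs_continuous t0 b x) ->
  cmeasurable t0 (fun s => x (Num.max t0 (s - d))).
Proof.
move=> d0 acx b; have [tb|bt] := leP t0 b; last first.
  rewrite set_itv_ge; first exact: measurable_fun_set0.
  by rewrite bnd_simp -ltNge.
apply: (@eq_measurable_fun _ _ (completedR R) R _ (fun s => x (Num.max t0 (Num.min (s - d) b)))).
  move=> s; rewrite inE/= in_itv/= => /andP[_ sb].
  by rewrite (min_l (_ : s - d <= b))//; lra.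
apply: continuous_cmeasurable => s.
apply: (@continuous_comp _ _ _ (fun s => s - d) (fun s => x (Num.max t0 (Num.min s b)))).
  by apply: cvgB; [exact: cvg_id|exact: cvg_cst].
exact: (continuous_clamp tb (acx _ tb)).
Qed.

(** The Caratheodory conditions. The bound is by a locally integrable function
    and not by a constant, so that the linear systems, whose coefficients need
    not be locally bounded, are included. *)
Definition caratheodory (R : realType) (t0 : R) (X : R -> R -> R -> R) : Prop :=
  [/\ forall u v, cmeasurable t0 (fun t => X t u v),
      forall t, t0 <= t -> continuous (fun z : R * R => X t z.1 z.2) &
      forall b M, exists2 m, loc_integrable t0 m & forall t u v,
        t0 <= t -> t <= b -> `|u| <= M -> `|v| <= M -> `|X t u v| <= m t].

Section dominated.
Context {R : realType} (t0 : R) (X : R -> R -> R -> R).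
Hypothesis mX : forall u v, cmeasurable t0 (fun t => X t u v).
Hypothesis cX : forall t, t0 <= t -> continuous (fun z : R * R => X t z.1 z.2).

Lemma cmeasurable_comp (x y : R -> R) : cmeasurable t0 x -> cmeasurable t0 y ->
  cmeasurable t0 (fun t => X t (x t) (y t)).
Proof.
move=> mx my b; apply: caratheodory_comp_measurable.
- exact: borel_completed.
- exact: mx.
- exact: my.
- by move=> u v; exact: mX.
- by move=> t /=; rewrite in_itv/= => /andP[tt _]; exact: cX.
Qed.

Lemma dominated_loc_integrable (k : R -> R) : cmeasurable t0 k ->
  (forall b, exists2 m, loc_integrable t0 m &
     forall t, t0 <= t -> t <= b -> `|k t| <= m t) ->
  loc_integrable t0 k.
Proof.
move=> mk dk b; have [m im km] := dk b.
apply: le_integrable (im b) => //; first exact: borel_completed.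
- by apply/measurable_EFinP; exact: mk.
- move=> t; rewrite /= in_itv/= => /andP[tt tb].
  by rewrite lee_fin (le_trans (km _ tt tb))// ler_norm.
Qed.

Lemma caratheodory_limit (m a b : R -> R) (a_ b_ : nat -> R -> R) (t : R) :
  loc_integrable t0 m ->
  (forall s u v, t0 <= s -> s <= t -> `|X s u v| <= m s) ->
  (forall n, cmeasurable t0 (a_ n)) -> (forall n, cmeasurable t0 (b_ n)) ->
  cmeasurable t0 a -> cmeasurable t0 b ->
  (forall s, t0 <= s -> s <= t -> a_ n s @[n --> \oo] --> a s) ->
  (forall s, t0 <= s -> s <= t -> b_ n s @[n --> \oo] --> b s) ->
  (\int[@completed_lebesgue_measure R]_(s in `[t0, t]) X s (a_ n s) (b_ n s))
    @[n --> \oo] -->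
  \int[@completed_lebesgue_measure R]_(s in `[t0, t]) X s (a s) (b s).
Proof.
move=> im Xm ma_ mb_ ma mb cva cvb.
have mt : @measurable _ (completedR R) `[t0, t] by exact: borel_completed.
pose f_ n s := (X s (a_ n s) (b_ n s))%:E.
pose f s := (X s (a s) (b s))%:E.
have := @dominated_convergence _ _ _ (@completed_lebesgue_measure R) _ mt f_ f (EFin \o m).
case.
- by move=> n; apply/measurable_EFinP; exact: cmeasurable_comp.
- by apply/measurable_EFinP; exact: cmeasurable_comp.
- apply: aeW => s /=; rewrite in_itv/= => /andP[ts st].
  have h : X s (a_ n s) (b_ n s) @[n --> \oo] --> X s (a s) (b s).
    exact: (@cvg_comp2 _ _ _ _ _ _ _ _ _ _ _ _ _ (X s) (cva s ts st) (cvb s ts st)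
      (@cX s ts (a s, b s))).
  by apply: cvg_EFin; [near=> n|exact: h].
- exact: im.
- apply: aeW => s n /=; rewrite in_itv/= => /andP[ts st].
  by rewrite lee_fin; exact: Xm.
move=> intf _ cvf.
apply: fine_cvg; rewrite fineK; last exact: integrable_fin_num.
exact: cvf.
Unshelve. all: by end_near. Qed.

End dominated.

(** * Tonelli's approximations *)

Lemma primitive_left (R : realType) (t0 t : R) (k : R -> R) :
  loc_integrable t0 k -> t <= t0 ->
  \int[@completed_lebesgue_measure R]_(s in `[t0, t]) k s = 0.
Proof.
move=> /loc_integrable_borel[g [_ _ _ -> _]]; rewrite le_eqVlt => /predU1P[->|tt].
  by rewrite set_itv1 Rintegral_set1.
by rewrite set_itv_ge ?Rintegral_set0// bnd_simp -ltNge.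
Qed.

Section tonelli.
Context {R : realType} (t0 : R) (X Y : R -> R -> R -> R) (alpha beta : R).
Hypothesis mX : forall u v, cmeasurable t0 (fun t => X t u v).
Hypothesis mY : forall u v, cmeasurable t0 (fun t => Y t u v).
Hypothesis cX : forall t, t0 <= t -> continuous (fun z : R * R => X t z.1 z.2).
Hypothesis cY : forall t, t0 <= t -> continuous (fun z : R * R => Y t z.1 z.2).
Hypothesis dXY : forall b, exists2 m, loc_integrable t0 m &
  forall t u v, t0 <= t -> t <= b -> `|X t u v| <= m t /\ `|Y t u v| <= m t.

Let I (k : R -> R) (t : R) := \int[@completed_lebesgue_measure R]_(s in `[t0, t]) k s.

Let lX x y : cmeasurable t0 x -> cmeasurable t0 y ->
  loc_integrable t0 (fun s => X s (x s) (y s)).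
Proof.
move=> mx my; apply: dominated_loc_integrable; first exact: cmeasurable_comp.
by move=> b; have [m im mP] := dXY b; exists m => // t tt tb; have [] := mP t (x t) (y t) tt tb.
Qed.

Let lY x y : cmeasurable t0 x -> cmeasurable t0 y ->
  loc_integrable t0 (fun s => Y s (x s) (y s)).
Proof.
move=> mx my; apply: dominated_loc_integrable; first exact: cmeasurable_comp.
by move=> b; have [m im mP] := dXY b; exists m => // t tt tb; have [] := mP t (x t) (y t) tt tb.
Qed.

Definition delay (d : R) (x : R -> R) (s : R) : R := x (Num.max t0 (s - d)).

(** The integral form of the system in which the unknowns are evaluated [d]
    time units earlier, on the right-hand side only. *)
Definition tonelli_step (d : R) (w : (R -> R) * (R -> R)) : (R -> R) * (R -> R) :=
  (fun t => alpha + \int[@completed_lebesgue_measure R]_(s in `[t0, t])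
      X s (delay d w.1 s) (delay d w.2 s),
   fun t => beta + \int[@completed_lebesgue_measure R]_(s in `[t0, t])
      Y s (delay d w.1 s) (delay d w.2 s)).

Definition tonelli (d : R) (k : nat) := iter k (tonelli_step d) (cst alpha, cst beta).

Lemma tonelliS d k : tonelli d k.+1 = tonelli_step d (tonelli d k).
Proof. by []. Qed.

Lemma tonelli_step_ac d w : 0 <= d ->
  (forall b, t0 <= b -> abs_continuous t0 b w.1 /\ abs_continuous t0 b w.2) ->
  ac_deriv t0 +oo%E (tonelli_step d w).1 (fun s => X s (delay d w.1 s) (delay d w.2 s)) /\
  ac_deriv t0 +oo%E (tonelli_step d w).2 (fun s => Y s (delay d w.1 s) (delay d w.2 s)).
Proof.
move=> d0 acw.
have m1 : cmeasurable t0 (delay d w.1) by apply: delay_cmeasurable => // b /acw[].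
have m2 : cmeasurable t0 (delay d w.2) by apply: delay_cmeasurable => // b /acw[].
have h1 := ac_derivD (ac_deriv_cst t0 +oo%E alpha) (loc_integrable_primitive (lX m1 m2)).
have h2 := ac_derivD (ac_deriv_cst t0 +oo%E beta) (loc_integrable_primitive (lY m1 m2)).
split; first by apply: eq_ac_deriv h1 => t _ _; rewrite add0r.
by apply: eq_ac_deriv h2 => t _ _; rewrite add0r.
Qed.

Lemma tonelli_ac d k : 0 <= d -> forall b, t0 <= b ->
  abs_continuous t0 b (tonelli d k).1 /\ abs_continuous t0 b (tonelli d k).2.
Proof.
move=> d0; elim: k => [|k IH] b tb /=.
  by split; apply: (ac_deriv_cst t0 +oo%E _).1 => //; exact: ltry.
by have [[h1 _] [h2 _]] := tonelli_step_ac d0 IH; split; [apply: h1|apply: h2]; rewrite ?ltry.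
Qed.

(** With a delay [d] the right-hand side on [[t0, t0 + k.+1 * d]] only sees the
    unknowns on [[t0, t0 + k * d]], so that each iteration settles one more
    interval of length [d]. *)
Lemma tonelli_stable d k t : 0 <= d -> t <= t0 + k%:R * d ->
  (tonelli d k.+1).1 t = (tonelli d k).1 t /\ (tonelli d k.+1).2 t = (tonelli d k).2 t.
Proof.
move=> d0; elim: k t => [|k IH] t.
  rewrite mul0r addr0 => tt /=.
  have mc (c : R) : cmeasurable t0 (delay d (cst c)) by exact/continuous_cmeasurable/cst_continuous.
  have := primitive_left (lX (mc alpha) (mc beta)) tt.
  have := primitive_left (lY (mc alpha) (mc beta)) tt.
  by move=> -> ->; rewrite !addr0.
rewrite -natr1 mulrDl mul1r => tk; rewrite (tonelliS d k.+1) [in RHS](tonelliS d k).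
rewrite [in X in _ /\ X](tonelliS d k) /=.
have E s : s \in `[t0, t]%classic ->
    delay d (tonelli d k.+1).1 s = delay d (tonelli d k).1 s /\
    delay d (tonelli d k.+1).2 s = delay d (tonelli d k).2 s.
  rewrite inE/= in_itv/= => /andP[ts st]; apply: IH.
  rewrite ge_max; apply/andP; split; last by lra.
  by rewrite lerDl mulr_ge0.
by split; congr (_ + _); apply: eq_Rintegral => s /E[-> ->].
Qed.

Let h (n : nat) : R := n.+1%:R^-1.
(* After [K n] steps of length [h n] the iteration is settled up to
   [t0 + n.+1]. *)
Let K (n : nat) : nat := (n.+1 * n.+1)%N.
Let w n := tonelli (h n) (K n).
Let z n := tonelli (h n) (K n).+1.

Let h0 n : 0 <= h n. Proof. by rewrite invr_ge0. Qed.

Let zw n t : t <= t0 + n.+1%:R -> (z n).1 t = (w n).1 t /\ (z n).2 t = (w n).2 t.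
Proof.
move=> tn; apply: tonelli_stable => //.
by rewrite /K /h natrM mulfK// pnatr_eq0.
Qed.

Let zac n :
  ac_deriv t0 +oo%E (z n).1
    (fun s => X s (delay (h n) (w n).1 s) (delay (h n) (w n).2 s)) /\
  ac_deriv t0 +oo%E (z n).2
    (fun s => Y s (delay (h n) (w n).1 s) (delay (h n) (w n).2 s)).
Proof. by apply: tonelli_step_ac => //; exact: (tonelli_ac (K n) (h0 n)). Qed.

Let mw1 n : cmeasurable t0 (delay (h n) (w n).1).
Proof. by apply: delay_cmeasurable => // b tb; have [] := tonelli_ac (K n) (h0 n) tb. Qed.

Let mw2 n : cmeasurable t0 (delay (h n) (w n).2).
Proof. by apply: delay_cmeasurable => // b tb; have [] := tonelli_ac (K n) (h0 n) tb. Qed.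

Let zt0 n : (z n).1 t0 = alpha /\ (z n).2 t0 = beta.
Proof.
rewrite /z tonelliS /=.
have := primitive_left (lX (mw1 n) (mw2 n)) (lexx t0).
have := primitive_left (lY (mw1 n) (mw2 n)) (lexx t0).
by move=> -> ->; rewrite !addr0.
Qed.

Let zdom b m n x y : loc_integrable t0 m ->
  (forall t u v, t0 <= t -> t <= b -> `|X t u v| <= m t /\ `|Y t u v| <= m t) ->
  t0 <= x -> x <= y -> y <= b ->
  `|(z n).1 y - (z n).1 x| <= I m y - I m x /\
  `|(z n).2 y - (z n).2 x| <= I m y - I m x.
Proof.
move=> im mP tx xy yb; have [z1 z2] := zac n.
have acI := loc_integrable_primitive im.
split.
  apply: (ac_deriv_dominated z1 acI tx xy (ltry _)) => t xt ty.
  exact: (proj1 (mP t _ _ (le_trans tx xt) (le_trans ty yb))).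
apply: (ac_deriv_dominated z2 acI tx xy (ltry _)) => t xt ty.
exact: (proj2 (mP t _ _ (le_trans tx xt) (le_trans ty yb))).
Qed.

Let zbounded t : t0 <= t -> exists B : R, forall n, `|(z n).1 t| <= B /\ `|(z n).2 t| <= B.
Proof.
move=> tt; have [m im mP] := dXY t.
exists (`|alpha| + `|beta| + (I m t - I m t0)) => n.
have [h1 h2] := zdom n im mP (lexx t0) tt (lexx t).
have [e1 e2] := zt0 n; rewrite e1 in h1; rewrite e2 in h2.
have := ler_normD ((z n).1 t - alpha) alpha; rewrite subrK.
have := ler_normD ((z n).2 t - beta) beta; rewrite subrK.
have := normr_ge0 alpha; have := normr_ge0 beta.
by move=> ? ? ? ?; split; lra.
Qed.

Let zequi t e : t0 <= t -> 0 < e -> exists2 d : R, 0 < d & forall n t',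
  t0 <= t' -> `|t' - t| < d ->
  `|(z n).1 t' - (z n).1 t| <= e /\ `|(z n).2 t' - (z n).2 t| <= e.
Proof.
move=> tt e0; have [m im mP] := dXY (t + 1).
have tt1 : t0 <= t + 1 by lra.
have [acI _] := loc_integrable_primitive im.
have [d d0 hd] := abs_continuous_unif (acI (t + 1) tt1 (ltry _)) e0.
exists (Num.min d 1) => [|n t' tt']; first by rewrite lt_min d0 ltr01.
rewrite lt_min => /andP[td]; rewrite ltr_norml => /andP[_ t1].
have := hd t t' tt ltac:(lra) tt' ltac:(lra) td; rewrite -/(I m _) -/(I m t) => Id.
have [tle|tle] := leP t t'.
  have Ie : I m t' - I m t <= e := le_trans (ler_norm _) (ltW Id).
  have [h1 h2] := zdom n im mP tt tle ltac:(lra).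
  by split; [exact: le_trans h1 Ie|exact: le_trans h2 Ie].
rewrite distrC in Id.
have Ie : I m t - I m t' <= e := le_trans (ler_norm _) (ltW Id).
have [h1 h2] := zdom n im mP tt' (ltW tle) ltac:(lra).
rewrite (distrC (_ t')) (distrC ((z n).2 t')).
by split; [exact: le_trans h1 Ie|exact: le_trans h2 Ie].
Qed.

(** The delayed solutions have increments bounded by those of the primitive of
    [m], hence are equicontinuous. The limit of a subsequence satisfies the
    integral equation without delay, by dominated convergence. *)
Lemma caratheodory_bounded_exists : exists x y : R -> R,
  [/\ ac_deriv t0 +oo%E x (fun t => X t (x t) (y t)),
      ac_deriv t0 +oo%E y (fun t => Y t (x t) (y t)),
      x t0 = alpha & y t0 = beta].
Proof.
have [s1 [x [s1k hx]]] : exists (sg : nat -> nat) (l : R -> R), (forall k, (k <= sg k)%N) /\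
    forall k t, t0 <= t -> t <= t0 + k%:R -> `|(z (sg k)).1 t - l t| <= k.+1%:R^-1.
  apply: (@equicontinuous_subsequence _ t0 (fun n => (z n).1)).
    by move=> t /zbounded[B HB]; exists B => n; have [] := HB n.
  by move=> t e tt e0; have [d d0 hd] := zequi tt e0; exists d => // n t' tt' /(hd n _ tt')[].
have [s2 [y [s2k hy]]] : exists (sg : nat -> nat) (l : R -> R), (forall k, (k <= sg k)%N) /\
    forall k t, t0 <= t -> t <= t0 + k%:R -> `|(z (s1 (sg k))).2 t - l t| <= k.+1%:R^-1.
  apply: (@equicontinuous_subsequence _ t0 (fun n => (z (s1 n)).2)).
    by move=> t /zbounded[B HB]; exists B => n; have [] := HB (s1 n).
  by move=> t e tt e0; have [d d0 hd] := zequi tt e0; exists d => // n t' tt' /(hd (s1 n) _ tt')[].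
pose sg k := s1 (s2 k).
have sgk k : (k <= sg k)%N by exact: leq_trans (s2k k) (s1k _).
have big t : \forall k \near \oo, t <= t0 + k%:R.
  near=> k; rewrite -lerBlDl; near: k; exact: nbhs_infty_ger.
have cvx t : t0 <= t -> (z (sg k)).1 t @[k --> \oo] --> x t.
  move=> tt; apply/cvgrPdist_le => e e0; near=> k.
  rewrite distrC; apply: le_trans (hx (s2 k) t tt _) _.
    have tk : t <= t0 + k%:R by near: k; exact: big.
    by rewrite (le_trans tk)// lerD2l ler_nat.
  apply: (@le_trans _ _ k.+1%:R^-1); last first.
    by apply: ltW; near: k; exact: near_infty_natSinv_lt (PosNum e0).
  by rewrite lef_pV2 ?posrE ?ltr0n// ler_nat ltnS.
have cvy t : t0 <= t -> (z (sg k)).2 t @[k --> \oo] --> y t.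
  move=> tt; apply/cvgrPdist_le => e e0; near=> k.
  rewrite distrC; apply: le_trans (hy k t tt _) _.
    by near: k; exact: big.
  by apply: ltW; near: k; exact: near_infty_natSinv_lt (PosNum e0).
(* The delays tend to [0], so that by equicontinuity the delayed functions
   have the same limits. *)
have dly s : t0 <= s ->
    delay (h (sg k)) (w (sg k)).1 s @[k --> \oo] --> x s /\
    delay (h (sg k)) (w (sg k)).2 s @[k --> \oo] --> y s.
  move=> ts.
  have E e : 0 < e -> \forall k \near \oo,
      `|delay (h (sg k)) (w (sg k)).1 s - (z (sg k)).1 s| <= e /\
      `|delay (h (sg k)) (w (sg k)).2 s - (z (sg k)).2 s| <= e.
    move=> e0; have [d d0 hd] := zequi ts e0; near=> k.
    have hk : h (sg k) < d.
      apply: (@le_lt_trans _ _ k.+1%:R^-1).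
        by rewrite lef_pV2 ?posrE ?ltr0n// ler_nat ltnS.
      by near: k; exact: near_infty_natSinv_lt (PosNum d0).
    have h0k := h0 (sg k).
    rewrite /delay; set s' := Num.max t0 (s - h (sg k)).
    have ts' : t0 <= s' by rewrite le_max lexx.
    have ss' : s' <= s by rewrite ge_max ts/= lerBlDr lerDl.
    have sd : `|s' - s| < d.
      have : s - h (sg k) <= s' by rewrite le_max lexx orbT.
      by rewrite ltr_norml => ?; apply/andP; split; lra.
    have sk : s <= t0 + k%:R by near: k; exact: big.
    have [|<- <-] := @zw (sg k) s'; last exact: hd.
    rewrite (le_trans ss')// (le_trans sk)// lerD2l ler_nat.
    by rewrite (leq_trans (sgk k)).
  split; apply/cvgrPdist_le => e e0; have e20 : 0 < e / 2 by rewrite divr_gt0.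
    have /cvgrPdist_le/(_ _ e20) c1 := cvx s ts; near=> k.
    have [h1 _] : `|delay (h (sg k)) (w (sg k)).1 s - (z (sg k)).1 s| <= e / 2 /\
      `|delay (h (sg k)) (w (sg k)).2 s - (z (sg k)).2 s| <= e / 2.
      by near: k; exact: E.
    have h2 : `|x s - (z (sg k)).1 s| <= e / 2 by near: k.
    have := ler_distD ((z (sg k)).1 s) (x s) (delay (h (sg k)) (w (sg k)).1 s).
    by rewrite (distrC ((z (sg k)).1 s)); lra.
  have /cvgrPdist_le/(_ _ e20) c1 := cvy s ts; near=> k.
  have [_ h1] : `|delay (h (sg k)) (w (sg k)).1 s - (z (sg k)).1 s| <= e / 2 /\
    `|delay (h (sg k)) (w (sg k)).2 s - (z (sg k)).2 s| <= e / 2.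
    by near: k; exact: E.
  have h2 : `|y s - (z (sg k)).2 s| <= e / 2 by near: k.
  have := ler_distD ((z (sg k)).2 s) (y s) (delay (h (sg k)) (w (sg k)).2 s).
  by rewrite (distrC ((z (sg k)).2 s)); lra.
have mx : cmeasurable t0 x.
  move=> b; refine (@measurable_fun_cvg _ (completedR R) R _
    (fun k => delay (h (sg k)) (w (sg k)).1) x _ _) => [k|s].
    exact: mw1.
  by rewrite /= in_itv/= => /andP[/dly[]].
have my : cmeasurable t0 y.
  move=> b; refine (@measurable_fun_cvg _ (completedR R) R _
    (fun k => delay (h (sg k)) (w (sg k)).2) y _ _) => [k|s].
    exact: mw2.
  by rewrite /= in_itv/= => /andP[/dly[]].
have xE t : t0 <= t -> x t = alpha + I (fun s => X s (x s) (y s)) t.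
  move=> tt; have [m im mP] := dXY t.
  suff cv : (z (sg k)).1 t @[k --> \oo] --> alpha + I (fun s => X s (x s) (y s)) t.
    exact: (cvg_unique (@Rhausdorff R) (cvx t tt) cv).
  apply: cvgD; first exact: cvg_cst.
  apply: (caratheodory_limit mX cX im _ (fun n => mw1 (sg n)) (fun n => mw2 (sg n)) mx my).
  - by move=> s u v ts st; have [] := mP s u v ts st.
  - by move=> s ts _; have [] := dly s ts.
  - by move=> s ts _; have [] := dly s ts.
have yE t : t0 <= t -> y t = beta + I (fun s => Y s (x s) (y s)) t.
  move=> tt; have [m im mP] := dXY t.
  suff cv : (z (sg k)).2 t @[k --> \oo] --> beta + I (fun s => Y s (x s) (y s)) t.
    exact: (cvg_unique (@Rhausdorff R) (cvy t tt) cv).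
  apply: cvgD; first exact: cvg_cst.
  apply: (caratheodory_limit mY cY im _ (fun n => mw1 (sg n)) (fun n => mw2 (sg n)) mx my).
  - by move=> s u v ts st; have [] := mP s u v ts st.
  - by move=> s ts _; have [] := dly s ts.
  - by move=> s ts _; have [] := dly s ts.
(* The limits are only known after [t0]; the integrals agree with them there
   and are defined everywhere, as two-sided derivatives require. *)
exists (fun t => alpha + I (fun s => X s (x s) (y s)) t),
  (fun t => beta + I (fun s => Y s (x s) (y s)) t).
have h1 := ac_derivD (ac_deriv_cst t0 +oo%E alpha) (loc_integrable_primitive (lX mx my)).
have h2 := ac_derivD (ac_deriv_cst t0 +oo%E beta) (loc_integrable_primitive (lY mx my)).
split.
- by apply: eq_ac_deriv h1 => t tt _; rewrite add0r -xE// -yE.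
- by apply: eq_ac_deriv h2 => t tt _; rewrite add0r -xE// -yE.
- by rewrite /I primitive_left ?addr0//; exact: lX.
- by rewrite /I primitive_left ?addr0//; exact: lY.
Unshelve. all: by end_near. Qed.

End tonelli.

(** * A priori bounds *)

Section loc_integrable.
Context {R : realType} (t0 : R).
Implicit Types f g : R -> R.

Let mitv b : @measurable _ (completedR R) `[t0, b].
Proof. exact: borel_completed. Qed.

Lemma loc_integrableD f g : loc_integrable t0 f -> loc_integrable t0 g ->
  loc_integrable t0 (fun t => f t + g t).
Proof.
by move=> If Ig b; have := integrableD (@mitv b) (If b) (Ig b).
Qed.

Lemma loc_integrableZ (c : R) f : loc_integrable t0 f ->
  loc_integrable t0 (fun t => c * f t).
Proof. by move=> If b; have := integrableZl (@mitv b) c (If b). Qed.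

Lemma loc_integrable_norm f : loc_integrable t0 f ->
  loc_integrable t0 (fun t => `|f t|).
Proof. by move=> If b; have := integrable_norm (If b). Qed.

Lemma loc_integrable_cst (c : R) : loc_integrable t0 (fun=> c).
Proof.
move=> b; apply/integrableP; split.
  by apply/measurable_EFinP; exact: measurable_cst.
rewrite /= integral_cst; last exact: mitv.
have itv_lty : (@lebesgue_measure R `[t0, b] < +oo)%E.
  by rewrite lebesgue_measure_itv/=; case: ifP => _; rewrite ?ltry// -EFinB ltry.
by apply: lte_mul_pinfty => //; rewrite lee_fin.
Qed.

Lemma loc_integrable_cmeasurable f : loc_integrable t0 f -> cmeasurable t0 f.
Proof. by move=> If b; have /integrableP[/measurable_EFinP] := If b. Qed.

Lemma abs_continuous_cmeasurable f :
  (forall b, t0 <= b -> abs_continuous t0 b f) -> cmeasurable t0 f.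
Proof.
move=> acf b; have := @delay_cmeasurable R t0 0 f (lexx 0) acf b.
apply: eq_measurable_fun => s; rewrite inE/= in_itv/= => /andP[ts _].
by rewrite subr0 max_r.
Qed.

End loc_integrable.

Definition clamp (R : realType) (M u : R) : R := Num.max (- M) (Num.min u M).

Section clamp.
Context {R : realType}.
Implicit Types M u : R.

Lemma clamp_norm M u : 0 <= M -> `|clamp M u| <= M.
Proof.
move=> M0; rewrite ler_norml /clamp le_max lexx ge_max ge_min lexx orbT andbT/=.
by lra.
Qed.

Lemma clamp_norm_le M u : 0 <= M -> `|clamp M u| <= `|u|.
Proof.
move=> M0; have := ler_norm u; have := ler_norm (- u); rewrite normrN /clamp ler_norml.
by case: (leP u M) => ?; [case: (leP (- M) u)|case: (leP (- M) M)] => ? ? ?; apply/andP; split; lra.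
Qed.

Lemma clamp_id M u : `|u| <= M -> clamp M u = u.
Proof. by rewrite ler_norml => /andP[? ?]; rewrite /clamp min_l// max_r. Qed.

Lemma clamp_gt0 M u : 0 < M -> 0 < u -> 0 < clamp M u.
Proof. by move=> M0 u0; rewrite /clamp lt_max lt_min u0 M0 orbT. Qed.

Lemma clamp_lt0 M u : 0 < M -> u < 0 -> clamp M u < 0.
Proof. by move=> M0 u0; rewrite /clamp gt_max gt_min u0 oppr_lt0 M0. Qed.

Lemma clamp_continuous M : 0 <= M -> continuous (clamp M).
Proof.
move=> M0; apply: (@continuous_clamp _ (- M) M id); first by lra.
move=> e e0; exists e => // n x y xy _ h.
rewrite (eq_bigr (fun i => y i - x i))// => i _.
by have [_ [? _]] := xy i; rewrite ger0_norm// subr_ge0.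
Qed.

End clamp.

Lemma normr_le1Dsqr (R : realDomainType) (a : R) : `|a| <= 1 + a ^+ 2.
Proof.
rewrite -(real_normK (num_real a)).
by have := sqr_ge0 (`|a| - 1); have := sqr_ge0 `|a|; nra.
Qed.

(** The derivative of [1 + phi ^+ 2 + psi ^+ 2] is at most
    [4 * K + 2 * H] times this function. Squares are used rather than
    absolute values because they are differentiable. *)
Lemma growth_bound (R : realType) (t0 : R) (T : \bar R) (phi phi' psi psi' K H J : R -> R) b :
  ac_deriv t0 T phi phi' -> ac_deriv t0 T psi psi' ->
  ac_deriv t0 T J (fun t => 4 * K t + 2 * H t) ->
  t0 <= b -> (b%:E < T)%E ->
  (forall t, t0 <= t -> t <= b -> [/\ 0 <= K t, 0 <= H t,
     phi t * phi' t <= `|phi t| * (K t * (`|phi t| + `|psi t|) + H t) &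
     psi t * psi' t <= `|psi t| * (K t * (`|phi t| + `|psi t|) + H t)]) ->
  1 + phi b ^+ 2 + psi b ^+ 2 <= (1 + phi t0 ^+ 2 + psi t0 ^+ 2) * expR (J b - J t0).
Proof.
move=> acp acq acJ tb bT gr.
have acN := ac_derivD (ac_derivD (ac_deriv_cst t0 T 1) (ac_derivM acp acp)) (ac_derivM acq acq).
have := gronwall acN acJ tb bT; rewrite -!expr2; apply => t tt tb'.
have [K0 H0 hp hq] := gr t tt tb'.
rewrite -!expr2 -(real_normK (num_real (phi t))) -(real_normK (num_real (psi t))).
move: hp hq; set a := `|phi t|; set c := `|psi t|.
have a0 : 0 <= a by exact: normr_ge0.
have c0 : 0 <= c by exact: normr_ge0.
move=> hp hq.
have h1 : (a + c) * H t <= (1 + a ^+ 2 + c ^+ 2) * H t.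
  apply: ler_wpM2r => //.
  by have := sqr_ge0 (a - 1); have := sqr_ge0 (c - 1); have := sqr_ge0 a; have := sqr_ge0 c; nra.
have h2 : (a + c) ^+ 2 * K t <= 2 * (1 + a ^+ 2 + c ^+ 2) * K t.
  apply: ler_wpM2r => //.
  by have := sqr_ge0 (a - c); nra.
have -> : phi t * phi' t + phi t * phi' t = 2 * (phi t * phi' t) by ring.
have -> : psi t * psi' t + psi t * psi' t = 2 * (psi t * psi' t) by ring.
rewrite add0r.
have : a * (K t * (a + c) + H t) + c * (K t * (a + c) + H t) =
    (a + c) ^+ 2 * K t + (a + c) * H t by ring.
by lra.
Qed.

(** * Global existence and continuation *)

Lemma piecewise_cmeasurable (R : realType) (t0 r u : R) (phi : R -> R) :
  t0 < r -> loc_abs_continuous t0 r%:E phi ->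
  cmeasurable t0 (fun t => if t < r then phi t else u).
Proof.
move=> t0r acp b.
(* These points are in [[t0, r[] and converge to [r]. *)
pose rn (n : nat) := r - (r - t0) / n.+1%:R.
have rnr n : rn n < r by rewrite /rn gtrDl oppr_lt0 divr_gt0// subr_gt0.
have trn n : t0 <= rn n.
  rewrite /rn lerBrDl -lerBrDr ler_pdivrMr// ler_peMr ?subr_ge0 ?(ltW t0r)//.
  by rewrite ler1n.
pose E (n : nat) : set (completedR R) :=
  if n is k.+1 then `[t0, b] `&` `]-oo, rn k] else `[t0, b] `&` `[r, +oo[.
have -> : `[t0, b]%classic = \bigcup_n E n.
  apply/seteqP; split=> [t tb|t [[|n] _ []//]].
  have [rt|tr] := leP r t; first by exists 0%N => //; split=> //=; rewrite in_itv/= rt.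
  near \oo => n; exists n.+1 => //; split=> //=; rewrite in_itv/= /rn.
  rewrite lerBrDl -lerBrDr ler_pdivrMr// mulrC -ler_pdivrMr ?subr_gt0//.
  rewrite (@le_trans _ _ n%:R)// ?ler_nat//.
  by near: n; exact: nbhs_infty_ger.
have mI (i : interval R) : @measurable _ (completedR R) [set` i] by exact: borel_completed.
have mE n : measurable (E n) by case: n => [|n]; apply: measurableI; exact: mI.
apply/(measurable_fun_bigcup _ mE) => -[|n].
  apply: (@eq_measurable_fun _ _ (completedR R) R _ (cst u)); last exact: measurable_cst.
  by move=> t; rewrite inE => -[_ /=]; rewrite in_itv/= andbT ltNge => ->.
apply: (@eq_measurable_fun _ _ (completedR R) R _ (fun t => phi (Num.max t0 (Num.min t (rn n))))).
  move=> t; rewrite inE => -[/=]; rewrite !in_itv/= => /andP[tt _] tr.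
  by rewrite min_l// max_r// (le_lt_trans tr).
apply: (@measurable_funS _ _ (completedR R) R `[t0, b]); [exact: mI|by move=> t []|].
apply: continuous_cmeasurable; apply: continuous_clamp => //.
by apply: acp; rewrite ?lte_fin.
Unshelve. all: by end_near. Qed.

Section global.
Context {R : realType} (t0 : R) (X Y : R -> R -> R -> R) (K H : R -> R).
Hypothesis carX : caratheodory t0 X.
Hypothesis carY : caratheodory t0 Y.
Hypothesis iK : loc_integrable t0 K.
Hypothesis iH : loc_integrable t0 H.
Hypothesis K0 : forall t, t0 <= t -> 0 <= K t.
Hypothesis H0 : forall t, t0 <= t -> 0 <= H t.
Hypothesis grX : forall t u v, t0 <= t -> u * X t u v <= `|u| * (K t * (`|u| + `|v|) + H t).
Hypothesis grY : forall t u v, t0 <= t -> v * Y t u v <= `|v| * (K t * (`|u| + `|v|) + H t).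

Let clamp_growth (M u B A : R) : 0 < M -> clamp M u * A <= `|clamp M u| * B ->
  u * A <= `|u| * B.
Proof.
move=> M0; have [u0|u0|->] := ltgtP u 0; last by rewrite normr0 !mul0r.
  have c0 := clamp_lt0 M0 u0; rewrite !ltr0_norm// !mulNr -!mulrN.
  by rewrite !ler_nM2l.
have c0 := clamp_gt0 M0 u0; rewrite !gtr0_norm//.
by rewrite !ler_pM2l.
Qed.

(** The arguments of [X] and [Y] are truncated at the level [M t] which
    [growth_bound] gives for the initial data. The truncated system has right-hand
    sides bounded on each [[t0, b]] by integrable functions of time and still
    satisfies the growth conditions, so that its solution stays below [M t]
    and the truncation has no effect on it. *)
Lemma global_solution_exists (alpha beta : R) : exists phi psi : R -> R,
  [/\ is_solution X Y t0 +oo%E phi psi, phi t0 = alpha & psi t0 = beta].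
Proof.
pose k t := 4 * K t + 2 * H t.
have ik : loc_integrable t0 k.
  by apply: loc_integrableD; exact: loc_integrableZ.
have k0 t : t0 <= t -> 0 <= k t.
  by move=> tt; have := K0 tt; have := H0 tt; rewrite /k; lra.
pose J t := \int[@completed_lebesgue_measure R]_(s in `[t0, t]) k s.
have acJ : ac_deriv t0 +oo%E J k by exact: loc_integrable_primitive.
(* The value of [1 + phi ^+ 2 + psi ^+ 2] at [t0]. *)
pose N0 := 1 + alpha ^+ 2 + beta ^+ 2.
have N00 : 0 < N0 by rewrite /N0; have := sqr_ge0 alpha; have := sqr_ge0 beta; lra.
pose M t := N0 * expR (J t - J t0).
have M0 t : 0 < M t by rewrite mulr_gt0// expR_gt0.
have M0' t : 0 <= M t by exact: ltW.
have Mle s t : t0 <= s -> s <= t -> M s <= M t.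
  move=> ts st; rewrite (ler_pM2l N00) ler_expR lerD2r.
  by apply: (ac_deriv_nondecreasing acJ ts st (ltry _)) => r sr _; apply: k0; exact: le_trans sr.
have acM : ac_deriv t0 +oo%E M (fun t => N0 * (expR (J t - J t0) * (k t - 0))).
  exact: ac_derivZ (ac_deriv_expR (ac_derivB acJ (ac_deriv_cst _ _ _))).
have mM : cmeasurable t0 M.
  by apply: abs_continuous_cmeasurable => b tb; apply: acM.1; rewrite ?ltry.
have mc u : cmeasurable t0 (fun t => clamp (M t) u).
  move=> b; have mMb := mM b.
  have mNM := measurableT_comp (@oppr_measurable R setT) mMb.
  have mu := @measurable_cst _ _ (completedR R) R `[t0, b] u.
  exact: (measurable_maxr mNM (measurable_minr mu mMb)).
have [mX cX bX] := carX; have [mY cY bY] := carY.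
pose X1 t u v := X t (clamp (M t) u) (clamp (M t) v).
pose Y1 t u v := Y t (clamp (M t) u) (clamp (M t) v).
have mX1 u v : cmeasurable t0 (fun t => X1 t u v) by exact: (cmeasurable_comp mX cX (mc u) (mc v)).
have mY1 u v : cmeasurable t0 (fun t => Y1 t u v) by exact: (cmeasurable_comp mY cY (mc u) (mc v)).
have cont (Z : R -> R -> R -> R) t : continuous (fun z : R * R => Z t z.1 z.2) ->
    continuous (fun z : R * R => Z t (clamp (M t) z.1) (clamp (M t) z.2)).
  move=> cZ z.
  have h1 : clamp (M t) z'.1 @[z' --> z] --> clamp (M t) z.1.
    by apply: (cvg_comp _ _ (@cvg_fst _ _ (nbhs z.1) (nbhs z.2) _)); exact: clamp_continuous.
  have h2 : clamp (M t) z'.2 @[z' --> z] --> clamp (M t) z.2.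
    by apply: (cvg_comp _ _ (@cvg_snd _ _ (nbhs z.1) (nbhs z.2) _)); exact: clamp_continuous.
  exact: (@cvg_comp2 _ _ _ _ _ _ _ _ _ _ _ _ _ (Z t) h1 h2 (cZ (clamp (M t) z.1, clamp (M t) z.2))).
have cX1 t : t0 <= t -> continuous (fun z : R * R => X1 t z.1 z.2).
  by move=> tt; exact: (cont X t (@cX t tt)).
have cY1 t : t0 <= t -> continuous (fun z : R * R => Y1 t z.1 z.2).
  by move=> tt; exact: (cont Y t (@cY t tt)).
have dom b : exists2 m, loc_integrable t0 m & forall t u v, t0 <= t -> t <= b ->
    `|X1 t u v| <= m t /\ `|Y1 t u v| <= m t.
  have [m1 im1 hm1] := bX b (M b); have [m2 im2 hm2] := bY b (M b).
  exists (fun t => m1 t + m2 t); first exact: loc_integrableD.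
  move=> t u v tt tb.
  have cM w : `|clamp (M t) w| <= M b
    by exact: le_trans (clamp_norm w (M0' t)) (Mle t b tt tb).
  have h1 := hm1 t _ _ tt tb (cM u) (cM v).
  have h2 := hm2 t _ _ tt tb (cM u) (cM v).
  have := normr_ge0 (X1 t u v); have := normr_ge0 (Y1 t u v).
  by rewrite /X1 /Y1 => ? ?; split; lra.
have [x [y [acx acy xa yb]]] := caratheodory_bounded_exists alpha beta mX1 mY1 cX1 cY1 dom.
have bnd t : t0 <= t -> 1 + x t ^+ 2 + y t ^+ 2 <= M t.
  move=> tt; rewrite /M /N0 -xa -yb.
  apply: (growth_bound acx acy acJ tt (ltry _)) => s ts st.
  have clN u : `|clamp (M s) u| <= `|u| by exact: clamp_norm_le.
  have Kle u v : K s * (`|clamp (M s) u| + `|clamp (M s) v|) + H s <= K s * (`|u| + `|v|) + H s.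
    by rewrite lerD2r ler_wpM2l ?lerD// K0.
  split; [exact: K0|exact: H0| |].
    apply: (clamp_growth (M0 s)); apply: le_trans (grX _ _ ts) _.
    by rewrite ler_wpM2l.
  apply: (clamp_growth (M0 s)); apply: le_trans (grY _ _ ts) _.
  by rewrite ler_wpM2l.
have xM t : t0 <= t -> clamp (M t) (x t) = x t.
  move=> tt; apply: clamp_id; apply: le_trans (bnd t tt).
  by have := normr_le1Dsqr (x t); have := sqr_ge0 (y t); lra.
have yM t : t0 <= t -> clamp (M t) (y t) = y t.
  move=> tt; apply: clamp_id; apply: le_trans (bnd t tt).
  by have := normr_le1Dsqr (y t); have := sqr_ge0 (x t); lra.
exists x, y; split => //; apply/is_solutionE; split; first exact: ltry.
  by apply: eq_ac_deriv acx => t tt _; rewrite /X1 xM// yM.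
by apply: eq_ac_deriv acy => t tt _; rewrite /Y1 xM// yM.
Qed.

End global.

Section continuation.
Context {R : realType} (t0 : R) (X Y : R -> R -> R -> R) (K H : R -> R).
Hypothesis carX : caratheodory t0 X.
Hypothesis carY : caratheodory t0 Y.
Hypothesis iK : loc_integrable t0 K.
Hypothesis iH : loc_integrable t0 H.
Hypothesis K0 : forall t, t0 <= t -> 0 <= K t.
Hypothesis H0 : forall t, t0 <= t -> 0 <= H t.
Hypothesis grX : forall t u v, t0 <= t -> u * X t u v <= `|u| * (K t * (`|u| + `|v|) + H t).
Hypothesis grY : forall t u v, t0 <= t -> v * Y t u v <= `|v| * (K t * (`|u| + `|v|) + H t).

(** A solution on [[t0, r[] is bounded. Before [r] the right-hand sides are
    replaced by their values along the solution, after [r] they are kept: the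
    resulting system satisfies the same hypotheses, so that it has a solution
    on the whole half-line. Before [r] this solution has the same derivative as
    the given one and hence coincides with it; so it is a continuation of it. *)
Theorem maximal_solution_global (T : \bar R) (phi psi : R -> R) :
  is_maximal_solution X Y t0 T phi psi -> T = +oo%E.
Proof.
move=> [/is_solutionE[t0T acp acq] nex].
case: T => [r|//|] in t0T acp acq nex *; last by [].
exfalso; apply: nex.
have t0r : t0 < r by move: t0T; rewrite lte_fin.
pose k t := 4 * K t + 2 * H t.
have ik : loc_integrable t0 k.
  by apply: loc_integrableD; exact: loc_integrableZ.
have k0 t : t0 <= t -> 0 <= k t.
  by move=> tt; have := K0 tt; have := H0 tt; rewrite /k; lra.
pose J t := \int[@completed_lebesgue_measure R]_(s in `[t0, t]) k s.
have acJ : ac_deriv t0 +oo%E J k by exact: loc_integrable_primitive.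
pose M := (1 + phi t0 ^+ 2 + psi t0 ^+ 2) * expR (J r - J t0).
have bnd t : t0 <= t -> t < r -> 1 + phi t ^+ 2 + psi t ^+ 2 <= M.
  move=> tt tr; have acJr := ac_derivS (leey r%:E) acJ.
  apply: le_trans (growth_bound acp acq acJr tt _ _) _; first by rewrite lte_fin.
    by move=> s ts st; split; [exact: K0|exact: H0|exact: grX|exact: grY].
  apply: ler_wpM2l.
    by have := sqr_ge0 (phi t0); have := sqr_ge0 (psi t0); lra.
  rewrite ler_expR lerD2r; apply: (ac_deriv_nondecreasing acJ tt (ltW tr) (ltry _)).
  by move=> s ts _; apply: k0; exact: le_trans ts.
have pM t : t0 <= t -> t < r -> `|phi t| <= M.
  by move=> tt tr; have := bnd t tt tr; have := normr_le1Dsqr (phi t); have := sqr_ge0 (psi t); lra.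
have qM t : t0 <= t -> t < r -> `|psi t| <= M.
  by move=> tt tr; have := bnd t tt tr; have := normr_le1Dsqr (psi t); have := sqr_ge0 (phi t); lra.
(* Freezing the arguments, rather than the values, before [r] keeps the
   Caratheodory conditions a matter of composition. *)
pose frz (f : R -> R) t (u : R) := if t < r then f t else u.
have car Z : caratheodory t0 Z -> caratheodory t0 (fun t u v => Z t (frz phi t u) (frz psi t v)).
  move=> [mZ cZ bZ]; split=> [u v|t tt|b N].
  - exact: (cmeasurable_comp mZ cZ (piecewise_cmeasurable u t0r acp.1)
      (piecewise_cmeasurable v t0r acq.1)).
  - rewrite /frz; have [tr|tr] := ltP t r; last exact: cZ.
    by move=> z; exact: cvg_cst.
  - have [m im hm] := bZ b (Num.max N M); exists m => // t u v tt tb uN vN.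
    apply: hm => //; rewrite le_max /frz; case: ifPn => tr.
    + by rewrite pM// orbT.
    + by rewrite uN.
    + by rewrite qM// orbT.
    + by rewrite vN.
have [_ _ bX] := carX; have [_ _ bY] := carY.
have [m1 im1 hm1] := bX r M; have [m2 im2 hm2] := bY r M.
(* Before [r] the frozen right-hand sides are bounded by [m1] and [m2], which
   can be absorbed in the inhomogeneous part of the growth condition. *)
pose H1 t := H t + (`|m1 t| + `|m2 t|).
have iH1 : loc_integrable t0 H1.
  by apply: loc_integrableD => //; apply: loc_integrableD; exact: loc_integrable_norm.
have HH1 t : H t <= H1 t by rewrite lerDl addr_ge0.
have H10 t : t0 <= t -> 0 <= H1 t by move=> tt; apply: le_trans (HH1 t); exact: H0.
have gr1 t u v w : t0 <= t ->
    `|u| * (K t * (`|v| + `|w|) + H t) <= `|u| * (K t * (`|v| + `|w|) + H1 t).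
  by move=> tt; rewrite ler_wpM2l// lerD2l.
have gr2 t u v w A : t0 <= t -> `|A| <= `|m1 t| + `|m2 t| ->
    u * A <= `|u| * (K t * (`|v| + `|w|) + H1 t).
  move=> tt hA; apply: (le_trans (ler_norm _)); rewrite normrM ler_wpM2l//.
  apply: (le_trans hA); rewrite /H1 addrA lerDr addr_ge0 ?H0//.
  by rewrite mulr_ge0 ?K0// addr_ge0.
have grX1 t u v : t0 <= t ->
    u * X t (frz phi t u) (frz psi t v) <= `|u| * (K t * (`|u| + `|v|) + H1 t).
  move=> tt; rewrite /frz; have [tr|tr] := ltP t r; last first.
    by apply: le_trans (grX u v tt) _; exact: gr1.
  apply: gr2 => //; have := hm1 _ _ _ tt (ltW tr) (pM _ tt tr) (qM _ tt tr).
  by have := ler_norm (m1 t); have := normr_ge0 (m2 t); lra.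
have grY1 t u v : t0 <= t ->
    v * Y t (frz phi t u) (frz psi t v) <= `|v| * (K t * (`|u| + `|v|) + H1 t).
  move=> tt; rewrite /frz; have [tr|tr] := ltP t r; last first.
    by apply: le_trans (grY u v tt) _; exact: gr1.
  apply: gr2 => //; have := hm2 _ _ _ tt (ltW tr) (pM _ tt tr) (qM _ tt tr).
  by have := ler_norm (m2 t); have := normr_ge0 (m1 t); lra.
have [x [y [/is_solutionE[_ acx acy] xa ya]]] :=
  global_solution_exists (car _ carX) (car _ carY) iK iH1 K0 H10 grX1 grY1 (phi t0) (psi t0).
have eqs f f' g : ac_deriv t0 +oo%E f f' -> ac_deriv t0 r%:E g f' -> f t0 = g t0 ->
    forall t, t0 <= t -> t < r -> f t = g t.
  move=> acf acg fg t tt tr.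
  have acB := ac_derivB (ac_derivS (leey r%:E) acf) acg.
  have tr' : (t%:E < r%:E)%E by rewrite lte_fin.
  have := ac_deriv_dominated acB (ac_deriv_cst t0 r%:E 0) (lexx t0) tt tr'.
  have h s : t0 <= s -> s <= t -> `|f' s - f' s| <= 0 by rewrite subrr normr0.
  by move=> /(_ h); rewrite fg !subrr subr0 normr_le0 subr_eq0 => /eqP.
have xp t : t0 <= t -> t < r -> x t = phi t.
  move=> tt tr; apply: (eqs _ _ _ acx _ xa) => //; apply: eq_ac_deriv acp => s ts.
  by rewrite lte_fin => sr; rewrite /frz sr.
have yp t : t0 <= t -> t < r -> y t = psi t.
  move=> tt tr; apply: (eqs _ _ _ acy _ ya) => //; apply: eq_ac_deriv acq => s ts.
  by rewrite lte_fin => sr; rewrite /frz sr.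
exists +oo%E, x, y; split; first exact: ltry.
  apply/is_solutionE; split; first exact: ltry.
    by apply: eq_ac_deriv acx => t tt _; rewrite /frz; case: ifPn => // tr; rewrite xp// yp.
  by apply: eq_ac_deriv acy => t tt _; rewrite /frz; case: ifPn => // tr; rewrite xp// yp.
by move=> t tt; rewrite lte_fin => tr; rewrite xp// yp.
Qed.

End continuation.
(** * Linear majorants and comparison *)

Section coefficients.
Context {R : realType} (t0 : R).
Implicit Types a b c h : R -> R -> R -> R.

Lemma regular_caratheodory h : regular_coef t0 h -> caratheodory t0 h.
Proof.
move=> [ih ch bh]; split=> // [u v|b M]; first exact: loc_integrable_cmeasurable.
pose C : set (R * R * R) := `[t0, b]%classic `*` `[- M, M]%classic `*` `[- M, M]%classic.
have cC : compact C by do 2?apply: compact_setX; exact: segment_compact.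
have Ct0 : C `<=` [set x | t0 <= x.1.1].
  by move=> x [[/= + _] _]; rewrite in_itv/= => /andP[].
have [N [_ /(_ (N + 1))]] := bh C cC Ct0.
rewrite ltrDl => /(_ ltr01) hN.
exists (cst (N + 1)); first exact: loc_integrable_cst.
move=> t u v tt tb uM vM; apply: (hN (t, u, v)) => /=.
by rewrite /C /setX/= !in_itv/= tt tb -!ler_norml uM vM.
Qed.

Lemma loc_integrable_caratheodory (k : R -> R) : loc_integrable t0 k ->
  caratheodory t0 (fun t _ _ => k t).
Proof.
move=> ik; split=> [u v|t tt|b M]; first exact: loc_integrable_cmeasurable.
  exact: cst_continuous.
exists (fun t => `|k t|) => //; exact: loc_integrable_norm.
Qed.

Lemma caratheodory_rhs a b c : caratheodory t0 a -> caratheodory t0 b ->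
  caratheodory t0 c -> caratheodory t0 (rhs a b c).
Proof.
move=> [ma ca ba] [mb cb bb] [mc cc bc]; split=> [u v|t tt|d M].
- move=> d; apply: measurable_funD; last exact: mc.
  apply: measurable_funD.
    by apply: measurable_funM; [exact: ma|exact: measurable_cst].
  by apply: measurable_funM; [exact: mb|exact: measurable_cst].
- move=> z; apply: cvgD; last exact: cc.
  by apply: cvgD; apply: cvgM; [exact: ca|exact: cvg_fst|exact: cb|exact: cvg_snd].
- have [m1 i1 h1] := ba d M; have [m2 i2 h2] := bb d M; have [m3 i3 h3] := bc d M.
  exists (fun t => (M * m1 t + M * m2 t) + m3 t).
    apply: loc_integrableD => //; apply: loc_integrableD; exact: loc_integrableZ.
  move=> t u v tt td uM vM; rewrite /rhs.
  rewrite (le_trans (ler_normD _ _))// lerD//; last exact: h3.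
  rewrite (le_trans (ler_normD _ _))// lerD// normrM mulrC ler_pM//.
    exact: h1.
  exact: h2.
Qed.

End coefficients.

(** [A] enters through [A * u ^+ 2], which an upper bound of [A] controls from
    above. *)
Lemma linear_growth (R : realFieldType) (A B C A0 B0 C0 K H u v : R) :
  A <= A0 -> `|B| <= B0 -> `|C| <= C0 -> `|A0| + B0 <= K -> C0 <= H ->
  u * (A * u + B * v + C) <= `|u| * (K * (`|u| + `|v|) + H).
Proof.
move=> hA hB hC hK hH.
have hA' : A <= `|A0| by apply: le_trans hA _; exact: ler_norm.
have hu : A * u * u <= `|A0| * `|u| * `|u|.
  rewrite -!mulrA -(expr2 u) -(expr2 `|u|) -(real_normK (num_real u)).
  by rewrite ler_wpM2r// sqr_ge0.
have hv : u * (B * v) <= `|u| * (B0 * `|v|).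
  apply: le_trans (ler_norm _) _; rewrite !normrM ler_wpM2l//.
  by rewrite ler_wpM2r.
have hc : u * C <= `|u| * H.
  apply: le_trans (ler_norm _) _; rewrite normrM ler_wpM2l//.
  exact: le_trans hH.
have B00 : 0 <= B0 by apply: le_trans hB.
have hK' : `|u| * ((`|A0| + B0) * (`|u| + `|v|)) <= `|u| * (K * (`|u| + `|v|)).
  by rewrite ler_wpM2l// ler_wpM2r// addr_ge0.
have e1 : 0 <= `|A0| * `|v| * `|u| by rewrite !mulr_ge0.
have e2 : 0 <= B0 * `|u| * `|u| by rewrite !mulr_ge0.
by move: hu hv hc hK'; lra.
Qed.

Section system.
Context {R : realType} (t0 : R) (p q r s f g : R -> R -> R -> R).
Context (p0 q0 r0 s0 f0 g0 : R -> R).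
Hypothesis cp : caratheodory t0 p.
Hypothesis cq : caratheodory t0 q.
Hypothesis cr : caratheodory t0 r.
Hypothesis cs : caratheodory t0 s.
Hypothesis cf : caratheodory t0 f.
Hypothesis cg : caratheodory t0 g.
Hypothesis hp0 : loc_integrable t0 p0.
Hypothesis hq0 : loc_integrable t0 q0.
Hypothesis hr0 : loc_integrable t0 r0.
Hypothesis hs0 : loc_integrable t0 s0.
Hypothesis hf0 : loc_integrable t0 f0.
Hypothesis hg0 : loc_integrable t0 g0.
Hypothesis hle : forall t u v : R, t0 <= t ->
    (p t u v <= p0 t /\ `|q t u v| <= q0 t /\ `|r t u v| <= r0 t) /\
    (s t u v <= s0 t /\ `|f t u v| <= f0 t /\ `|g t u v| <= g0 t).

Let K t := `|p0 t| + q0 t + (r0 t + `|s0 t|).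
Let H t := f0 t + g0 t.

Let iK : loc_integrable t0 K.
Proof.
apply: loc_integrableD; apply: loc_integrableD => //; exact: loc_integrable_norm.
Qed.

Let iH : loc_integrable t0 H. Proof. exact: loc_integrableD. Qed.

Let ge0 t : t0 <= t -> [/\ 0 <= q0 t, 0 <= r0 t, 0 <= f0 t & 0 <= g0 t].
Proof.
move=> tt; have [[_ [hq hr]] [_ [hf hg]]] := hle 0 0 tt.
by split; [apply: le_trans hq|apply: le_trans hr|apply: le_trans hf|apply: le_trans hg].
Qed.

Let K0 t : t0 <= t -> 0 <= K t.
Proof. by move=> /ge0[? ? ? ?]; rewrite !addr_ge0. Qed.

Let H0 t : t0 <= t -> 0 <= H t.
Proof. by move=> /ge0[? ? ? ?]; rewrite addr_ge0. Qed.

Let grX t u v : t0 <= t -> u * rhs p q f t u v <= `|u| * (K t * (`|u| + `|v|) + H t).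
Proof.
move=> tt; have [[hp [hq hr]] [hs [hf hg]]] := hle u v tt.
have [? ? ? ?] := ge0 tt; rewrite /rhs.
by apply: (@linear_growth R _ _ _ _ _ _ (K t) (H t) u v hp hq hf); rewrite lerDl ?addr_ge0.
Qed.

Let grY t u v : t0 <= t -> v * rhs r s g t u v <= `|v| * (K t * (`|u| + `|v|) + H t).
Proof.
move=> tt; have [[hp [hq hr]] [hs [hf hg]]] := hle u v tt.
have [? ? ? ?] := ge0 tt.
rewrite /rhs (addrC (_ * u)) (addrC `|u|).
apply: (@linear_growth R _ _ _ _ _ _ (K t) (H t) v u hs hr hg); last by rewrite lerDr.
by rewrite (addrC `|s0 t|) lerDr addr_ge0.
Qed.

Lemma system_solution_exists (alpha beta : R) : exists phi psi : R -> R,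
  [/\ is_solution (rhs p q f) (rhs r s g) t0 +oo%E phi psi,
      phi t0 = alpha & psi t0 = beta].
Proof.
by apply: (global_solution_exists _ _ iK iH K0 H0 grX grY); exact: caratheodory_rhs.
Qed.

Lemma system_solution_maximal (T : \bar R) (phi psi : R -> R) :
  is_maximal_solution (rhs p q f) (rhs r s g) t0 T phi psi -> T = +oo%E.
Proof.
by apply: (maximal_solution_global _ _ iK iH K0 H0 grX grY); exact: caratheodory_rhs.
Qed.

(** The derivative of [x - x0] where [x] exceeds [x0]. As [0 <= x0 < x], the
    one-sided bound [P <= P0] suffices; [m] and [m'] stand for the positive
    parts of [y - y0] and [- y - y0], whose sum dominates [`|y| - y0]. *)
Let comparison_rate (P Q F P0 Q0 F0 k x y x0 y0 m m' S : R) :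
  P <= P0 -> `|Q| <= Q0 -> `|F| <= F0 -> `|P0| + Q0 <= k -> 0 <= x0 -> x0 < x ->
  0 <= m -> 0 <= m' -> y - y0 <= m -> - y - y0 <= m' ->
  (x - x0) + m + m' <= S ->
  P * x + Q * y + F - (P0 * x0 + Q0 * y0 + F0) <= k * S.
Proof.
move=> hP hQ hF hk x00 x0x m0 m'0 ym ym' mS.
have Q00 : 0 <= Q0 by apply: le_trans hQ.
have hPx : P * x <= P0 * x by rewrite ler_wpM2r//; lra.
have hPx0 : P0 * (x - x0) <= `|P0| * (x - x0).
  by rewrite ler_wpM2r ?ler_norm//; lra.
have hQy : Q * y <= Q0 * `|y|.
  by apply: le_trans (ler_norm _) _; rewrite normrM ler_wpM2r.
have yy : `|y| - y0 <= m + m'.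
  by case: (leP 0 y) => y_0; [rewrite ger0_norm//|rewrite ltr0_norm//]; lra.
have hQy0 : Q0 * (`|y| - y0) <= Q0 * (m + m') by rewrite ler_wpM2l.
have S0 : 0 <= S by lra.
have hkS : (`|P0| + Q0) * S <= k * S by rewrite ler_wpM2r.
have h1 : `|P0| * (x - x0) <= `|P0| * S by rewrite ler_wpM2l//; lra.
have h2 : Q0 * (m + m') <= Q0 * S by rewrite ler_wpM2l//; lra.
by have := ler_norm F; lra.
Qed.

Let positivity_rate (P Q F k x y m S : R) :
  0 <= Q -> 0 <= F -> `|P| + Q <= k -> 0 < x -> 0 <= m -> y <= m -> x + m <= S ->
  - (P * - x + Q * - y + F) <= k * S.
Proof.
move=> Q0 F0' hk x0 m0 ym mS.
have h1 : P * x <= `|P| * x by rewrite ler_wpM2r ?ler_norm// ltW.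
have h2 : Q * y <= Q * m by rewrite ler_wpM2l.
have S0 : 0 <= S by lra.
have hkS : (`|P| + Q) * S <= k * S by rewrite ler_wpM2r.
have h3 : `|P| * x <= `|P| * S by rewrite ler_wpM2l//; lra.
have h4 : Q * m <= Q * S by rewrite ler_wpM2l//; lra.
by lra.
Qed.

(** The coefficients [q0], [r0], [f0], [g0] are nonnegative because they bound
    absolute values; hence the linear system preserves the first quadrant. *)
Lemma linear_solution_ge0 (phi0 psi0 : R -> R) :
  is_solution (lin_rhs p0 q0 f0) (lin_rhs r0 s0 g0) t0 +oo%E phi0 psi0 ->
  0 <= phi0 t0 -> 0 <= psi0 t0 ->
  forall t, t0 <= t -> 0 <= phi0 t /\ 0 <= psi0 t.
Proof.
move=> /is_solutionE[_ acp0 acq0] phi00 psi00 t tt.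
have acJ := loc_integrable_primitive iK.
have maxl (x : R) : x <= Num.max x 0 by rewrite le_max lexx.
have max0 (x : R) : 0 <= Num.max x 0 by rewrite le_max lexx orbT.
pose w (i : 'I_2) := match val i with
  | 0%N => fun t => - phi0 t | _ => fun t => - psi0 t end.
pose w' (i : 'I_2) := match val i with
  | 0%N => fun t => - lin_rhs p0 q0 f0 t (phi0 t) (psi0 t)
  | _ => fun t => - lin_rhs r0 s0 g0 t (phi0 t) (psi0 t) end.
have acw i : ac_deriv t0 +oo%E (w i) (w' i).
  by rewrite /w /w'; case: (val i) => [|?]; exact: ac_derivN.
have wt0 i : w i t0 <= 0.
  by rewrite /w; case: (val i) => [|?]; rewrite oppr_le0.
have wk i u : t0 <= u -> u <= t -> 0 < w i u ->
    w' i u <= K u * \sum_(j < 2) Num.max (w j u) 0.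
  move=> tu _; have [? ? ? ?] := ge0 tu.
  rewrite !big_ord_recl big_ord0 addr0 /w /w' /lin_rhs /= /K.
  have := normr_ge0 (p0 u); have := normr_ge0 (s0 u) => ? ?.
  case: (val i) => [|?] w0.
    rewrite -[X in p0 u * X](opprK (phi0 u)) -[X in q0 u * X](opprK (psi0 u)).
    apply: (@positivity_rate _ _ _ _ (- phi0 u) _ (Num.max (- psi0 u) 0)) => //; first by lra.
    by rewrite lerD2r.
  rewrite (addrC (r0 u * _)) -[X in r0 u * X](opprK (phi0 u)) -[X in s0 u * X](opprK (psi0 u)).
  apply: (@positivity_rate _ _ _ _ (- psi0 u) _ (Num.max (- phi0 u) 0)) => //; first by lra.
  by rewrite addrC lerD2l.
have := quasimonotone_le0 acw acJ tt (ltry _) wt0 wk (fun u tu _ => K0 tu).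
move=> w0; have := w0 ord0; have := w0 (lift ord0 ord0).
by rewrite /w /= !oppr_le0.
Qed.

(** The inequality [`|phi| <= phi0] is the pair of inequalities
    [phi - phi0 <= 0] and [- phi - phi0 <= 0], to which [quasimonotone_le0]
    applies together with the pair for [psi]. *)
Lemma comparison (phi psi phi0 psi0 : R -> R) :
  is_solution (rhs p q f) (rhs r s g) t0 +oo%E phi psi ->
  is_solution (lin_rhs p0 q0 f0) (lin_rhs r0 s0 g0) t0 +oo%E phi0 psi0 ->
  `|phi t0| <= phi0 t0 -> `|psi t0| <= psi0 t0 ->
  forall t, t0 <= t -> `|phi t| <= phi0 t /\ `|psi t| <= psi0 t.
Proof.
move=> /is_solutionE[_ acp acq] sol0 hphi hpsi.
have [_ acp0 acq0] := (is_solutionE _ _ _ _ _ _).1 sol0.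
have acJ := loc_integrable_primitive iK.
have maxl (x : R) : x <= Num.max x 0 by rewrite le_max lexx.
have max0 (x : R) : 0 <= Num.max x 0 by rewrite le_max lexx orbT.
have pos : forall t, t0 <= t -> 0 <= phi0 t /\ 0 <= psi0 t.
  by apply: (linear_solution_ge0 sol0); [apply: le_trans hphi|apply: le_trans hpsi].
move=> t tt.
pose X t := rhs p q f t (phi t) (psi t); pose Y t := rhs r s g t (phi t) (psi t).
pose X0 t := lin_rhs p0 q0 f0 t (phi0 t) (psi0 t).
pose Y0 t := lin_rhs r0 s0 g0 t (phi0 t) (psi0 t).
pose w (i : 'I_4) := match val i with
  | 0%N => fun t => phi t - phi0 t | 1%N => fun t => - phi t - phi0 t
  | 2%N => fun t => psi t - psi0 t | _ => fun t => - psi t - psi0 t end.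
pose w' (i : 'I_4) := match val i with
  | 0%N => fun t => X t - X0 t | 1%N => fun t => - X t - X0 t
  | 2%N => fun t => Y t - Y0 t | _ => fun t => - Y t - Y0 t end.
have acw i : ac_deriv t0 +oo%E (w i) (w' i).
  by rewrite /w /w'; case: (val i) => [|[|[|?]]]; apply: ac_derivB => //; exact: ac_derivN.
have wt0 i : w i t0 <= 0.
  move: hphi hpsi; rewrite !ler_norml => /andP[? ?] /andP[? ?].
  by rewrite /w; case: (val i) => [|[|[|?]]]; lra.
have wk i u : t0 <= u -> u <= t -> 0 < w i u ->
    w' i u <= K u * \sum_(j < 4) Num.max (w j u) 0.
  move=> tu _; have [? ? ? ?] := ge0 tu; have [? ?] := pos u tu.
  rewrite !big_ord_recl big_ord0 addr0 /w /w' /= /K.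
  have [[hp [hq hr]] [hs [hf hg]]] := hle (phi u) (psi u) tu.
  have := normr_ge0 (p0 u); have := normr_ge0 (s0 u) => ? ?.
  set m1 := Num.max (phi u - phi0 u) 0; set m2 := Num.max (- phi u - phi0 u) 0.
  set m3 := Num.max (psi u - psi0 u) 0; set m4 := Num.max (- psi u - psi0 u) 0.
  have := max0 (phi u - phi0 u); have := max0 (- phi u - phi0 u).
  have := max0 (psi u - psi0 u); have := max0 (- psi u - psi0 u).
  have := maxl (phi u - phi0 u); have := maxl (- phi u - phi0 u).
  have := maxl (psi u - psi0 u); have := maxl (- psi u - psi0 u).
  rewrite -/m1 -/m2 -/m3 -/m4 => ? ? ? ? ? ? ? ?.
  rewrite /X /X0 /Y /Y0 /rhs /lin_rhs.
  case: (val i) => [|[|[|?]]] w0.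
  - apply: (@comparison_rate _ _ _ _ _ _ _ _ _ _ _ m3 m4 _ hp hq hf) => //; lra.
  - have -> (a b c : R) : - (a * phi u + b * psi u + c) = a * - phi u + b * - psi u + - c by ring.
    apply: (@comparison_rate _ _ _ _ _ _ _ _ _ _ _ m4 m3 _ hp hq) => //; rewrite ?normrN//; lra.
  - rewrite (addrC (_ * phi u)) (addrC (_ * phi0 u)).
    apply: (@comparison_rate _ _ _ _ _ _ _ _ _ _ _ m1 m2 _ hs hr hg) => //; lra.
  - rewrite (addrC (_ * phi u)) (addrC (_ * phi0 u)).
    have -> (a b c : R) : - (a * psi u + b * phi u + c) = a * - psi u + b * - phi u + - c by ring.
    apply: (@comparison_rate _ _ _ _ _ _ _ _ _ _ _ m2 m1 _ hs hr) => //; rewrite ?normrN//; lra.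
have w0 := quasimonotone_le0 acw acJ tt (ltry _) wt0 wk (fun u tu _ => K0 tu).
have h i (li : (i < 4)%N) := w0 (Ordinal li).
have := h 0%N isT; have := h 1%N isT; have := h 2%N isT; have := h 3%N isT.
rewrite /w /= => ? ? ? ?; rewrite !ler_norml.
by split; apply/andP; split; lra.
Qed.

End system.

(** * Transfer of boundedness and stability *)

Lemma rhs_homE (R : realType) (a b : R -> R -> R -> R) :
  rhs_hom a b = rhs a b (fun _ _ _ => 0).
Proof. by apply/funext => t; apply/funext => u; apply/funext => v; rewrite /rhs addr0. Qed.

Lemma lin_rhs_homE (R : realType) (a b : R -> R) :
  lin_rhs_hom a b = lin_rhs a b (fun=> 0).
Proof. by apply/funext => t; apply/funext => u; apply/funext => v; rewrite /lin_rhs addr0. Qed.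

Lemma is_maximal_solution_infty (R : realType) (X Y : R -> R -> R -> R) (t0 : R)
    (phi psi : R -> R) :
  is_solution X Y t0 +oo%E phi psi -> is_maximal_solution X Y t0 +oo%E phi psi.
Proof. by move=> sol; split=> // -[T [x [y [+ _ _]]]]; rewrite ltNge leey. Qed.

Lemma lin_hom_solutionZ (R : realType) (a b c d : R -> R) (t0 k : R) (T : \bar R)
    (phi psi : R -> R) :
  is_solution (lin_rhs_hom a b) (lin_rhs_hom c d) t0 T phi psi ->
  is_solution (lin_rhs_hom a b) (lin_rhs_hom c d) t0 T
    (fun t => k * phi t) (fun t => k * psi t).
Proof.
move=> /is_solutionE[tT acp acq]; apply/is_solutionE; split=> //.
  by apply: eq_ac_deriv (ac_derivZ k acp) => t _ _; rewrite /lin_rhs_hom; ring.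
by apply: eq_ac_deriv (ac_derivZ k acq) => t _ _; rewrite /lin_rhs_hom; ring.
Qed.

Lemma dominated_bounded (R : realType) (t0 : R) (phi phi0 : R -> R) :
  (forall t, t0 <= t -> `|phi t| <= phi0 t) ->
  [bounded phi0 t | t in `[t0, +oo[] -> [bounded phi t | t in `[t0, +oo[].
Proof.
move=> le0; rewrite /bounded_near; apply: filterS => M HM t tt.
apply: le_trans (HM t tt); apply: le_trans (ler_norm _).
by apply: le0; move: tt; rewrite /= in_itv/= andbT.
Qed.

Lemma dominated_cvg0 (R : realType) (t0 : R) (phi phi0 : R -> R) :
  (forall t, t0 <= t -> `|phi t| <= phi0 t) ->
  phi0 t @[t --> +oo] --> (0 : R) -> phi t @[t --> +oo] --> (0 : R).
Proof.
move=> le0 cv; apply/norm_cvg0P.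
apply: (@squeeze_cvgr _ _ _ _ (cst 0) phi0) => //; last exact: cvg_cst.
near=> t; rewrite normr_ge0/=; apply: le0.
near: t; apply: nbhs_pinfty_ge; exact: num_real.
Unshelve. all: by end_near. Qed.

Theorem theorem3p1 (R : realType) (t0 : R)
  (p q r s f g : R -> R -> R -> R) (p0 q0 r0 s0 f0 g0 : R -> R)
  (hp : regular_coef t0 p) (hq : regular_coef t0 q) (hr : regular_coef t0 r)
  (hs : regular_coef t0 s) (hf : regular_coef t0 f) (hg : regular_coef t0 g)
  (hp0 : loc_integrable t0 p0) (hq0 : loc_integrable t0 q0)
  (hr0 : loc_integrable t0 r0) (hs0 : loc_integrable t0 s0)
  (hf0 : loc_integrable t0 f0) (hg0 : loc_integrable t0 g0)
  (hle : forall t u v : R, t0 <= t ->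
    (p t u v <= p0 t /\ `|q t u v| <= q0 t /\ `|r t u v| <= r0 t) /\
    (s t u v <= s0 t /\ `|f t u v| <= f0 t /\ `|g t u v| <= g0 t)) :
  (forall alpha beta : R,
    (exists phi psi : R -> R,
      [/\ is_solution (rhs p q f) (rhs r s g) t0 +oo%E phi psi,
          phi t0 = alpha & psi t0 = beta]) /\
    (forall (T : \bar R) (phi psi : R -> R),
      is_maximal_solution (rhs p q f) (rhs r s g) t0 T phi psi ->
      phi t0 = alpha -> psi t0 = beta -> T = +oo%E)) /\
  (forall phi0 psi0 : R -> R,
    is_solution (lin_rhs p0 q0 f0) (lin_rhs r0 s0 g0) t0 +oo%E phi0 psi0 ->
    0 < phi0 t0 -> 0 < psi0 t0 ->
    (bounded_pair t0 phi0 psi0 ->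
     forall phi psi : R -> R,
       is_solution (rhs p q f) (rhs r s g) t0 +oo%E phi psi ->
       `|phi t0| <= phi0 t0 -> `|psi t0| <= psi0 t0 ->
       bounded_pair t0 phi psi) /\
    (vanishes phi0 psi0 ->
     forall phi psi : R -> R,
       is_solution (rhs p q f) (rhs r s g) t0 +oo%E phi psi ->
       `|phi t0| <= phi0 t0 -> `|psi t0| <= psi0 t0 ->
       vanishes phi psi)) /\
  (lyapunov_stable (lin_rhs_hom p0 q0) (lin_rhs_hom r0 s0) t0 (cst 0) (cst 0) ->
   lyapunov_stable (rhs_hom p q) (rhs_hom r s) t0 (cst 0) (cst 0)) /\
  (asymptotically_stable (lin_rhs_hom p0 q0) (lin_rhs_hom r0 s0) t0
     (cst 0) (cst 0) ->
   globally_asymptotically_stable (rhs_hom p q) (rhs_hom r s) t0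
     (cst 0) (cst 0)).
Proof.
have cp := regular_caratheodory hp; have cq := regular_caratheodory hq.
have cr := regular_caratheodory hr; have cs := regular_caratheodory hs.
have cf := regular_caratheodory hf; have cg := regular_caratheodory hg.
have i0 : loc_integrable t0 (fun=> 0) by exact: loc_integrable_cst.
have c0 : caratheodory t0 (fun _ _ _ => 0) by exact: loc_integrable_caratheodory.
have hle0 t u v : t0 <= t ->
    (p t u v <= p0 t /\ `|q t u v| <= q0 t /\ `|r t u v| <= r0 t) /\
    (s t u v <= s0 t /\ `|(0 : R)| <= 0 /\ `|(0 : R)| <= 0).
  by move=> tt; have [[? [? ?]] [? _]] := hle t u v tt; rewrite normr0.
have maxB T phi psi :
    is_maximal_solution (rhs_hom p q) (rhs_hom r s) t0 T phi psi -> T = +oo%E.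
  rewrite !rhs_homE; exact: (system_solution_maximal cp cq cr cs c0 c0 hp0 hq0 hr0 hs0 i0 i0 hle0).
have solD d : exists phi0 psi0 : R -> R,
    [/\ is_solution (lin_rhs_hom p0 q0) (lin_rhs_hom r0 s0) t0 +oo%E phi0 psi0,
      phi0 t0 = d & psi0 t0 = d].
  rewrite !lin_rhs_homE.
  apply: (@system_solution_exists _ t0 (fun t _ _ => p0 t) (fun t _ _ => q0 t)
    (fun t _ _ => r0 t) (fun t _ _ => s0 t) (fun _ _ _ => 0) (fun _ _ _ => 0)
    p0 q0 r0 s0 (fun=> 0) (fun=> 0)) => //; try exact: loc_integrable_caratheodory.
  move=> t u v tt; have [[_ [hq' hr']] _] := hle t 0 0 tt.
  rewrite !normr0 !lexx !ger0_norm ?lexx//.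
    by apply: le_trans hr'.
  by apply: le_trans hq'.
have compB phi psi phi0 psi0 :
    is_solution (rhs_hom p q) (rhs_hom r s) t0 +oo%E phi psi ->
    is_solution (lin_rhs_hom p0 q0) (lin_rhs_hom r0 s0) t0 +oo%E phi0 psi0 ->
    `|phi t0| <= phi0 t0 -> `|psi t0| <= psi0 t0 ->
    forall t, t0 <= t -> `|phi t| <= phi0 t /\ `|psi t| <= psi0 t.
  rewrite !rhs_homE !lin_rhs_homE; exact: comparison hp0 hq0 hr0 hs0 hle0 _ _ _ _.
split.
  move=> alpha beta; split.
    exact: (system_solution_exists cp cq cr cs cf cg hp0 hq0 hr0 hs0 hf0 hg0 hle).
  by move=> T phi psi /(system_solution_maximal cp cq cr cs cf cg hp0 hq0 hr0 hs0 hf0 hg0 hle).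
split.
  move=> phi0 psi0 sol0 _ _.
  split=> [[b1 b2]|[v1 v2]] phi psi sol h1 h2.
    have le0 := comparison hp0 hq0 hr0 hs0 hle sol sol0 h1 h2.
    by split; [apply: dominated_bounded b1|apply: dominated_bounded b2] => t /le0[].
  have le0 := comparison hp0 hq0 hr0 hs0 hle sol sol0 h1 h2.
  by split; [apply: dominated_cvg0 v1|apply: dominated_cvg0 v2] => t /le0[].
split.
  move=> stab e e0; have [d d0 hd] := stab e e0; exists d => // T phi psi solm.
  rewrite /= !subr0 => h1 h2; have Too := maxB _ _ _ solm; split => //.
  (* The positive solution starting at the corner of the square of initial
     data dominates all solutions of (B) that start in this square. *)
  have [phi0 [psi0 [sol0 e1 e2]]] := solD d.
  have := hd _ _ _ (is_maximal_solution_infty sol0).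
  rewrite /= !subr0 e1 e2 gtr0_norm// => /(_ (lexx d) (lexx d))[_ bd] t tt.
  have sol : is_solution (rhs_hom p q) (rhs_hom r s) t0 +oo%E phi psi.
    by rewrite -Too; case: solm.
  rewrite -e1 in h1; rewrite -e2 in h2.
  have [l1 l2] := compB _ _ _ _ sol sol0 h1 h2 t tt.
  have := bd t tt; rewrite /= !subr0 => -[b1 b2].
  split; first exact: le_trans l1 (le_trans (ler_norm _) b1).
  exact: le_trans l2 (le_trans (ler_norm _) b2).
move=> [d d0 hd] T phi psi solm; have Too := maxB _ _ _ solm; split => //.
have [phi0 [psi0 [sol0 e1 e2]]] := solD d.
have := hd _ _ _ (is_maximal_solution_infty sol0).
rewrite /= !subr0 e1 e2 gtr0_norm// => /(_ (lexx d) (lexx d))[_ [v1 v2]].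
have sol : is_solution (rhs_hom p q) (rhs_hom r s) t0 +oo%E phi psi.
  by rewrite -Too; case: solm.
(* By linearity the attracted solution of (D) can be scaled to dominate
   any initial data. *)
pose k := (`|phi t0| + `|psi t0|) / d.
have solk := lin_hom_solutionZ k sol0.
have kd : k * d = `|phi t0| + `|psi t0| by rewrite /k divfK// gt_eqF.
have h1 : `|phi t0| <= k * phi0 t0 by rewrite e1 kd lerDl.
have h2 : `|psi t0| <= k * psi0 t0 by rewrite e2 kd lerDr.
have le0 := compB _ _ _ _ sol solk h1 h2.
have sub0 (h : R -> R) : h \- cst 0 = h by apply/funext => t; rewrite /= subr0.
rewrite !sub0 in v1 v2 *; split.
  apply: (@dominated_cvg0 _ t0 _ (fun t => k * phi0 t)); first by move=> t /le0[].
  by rewrite -(mulr0 k); apply: cvgM => //; exact: cvg_cst.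
apply: (@dominated_cvg0 _ t0 _ (fun t => k * psi0 t)); first by move=> t /le0[].
by rewrite -(mulr0 k); apply: cvgM => //; exact: cvg_cst.
Qed.
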